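(* Let $M^2$ be a spacelike surface in $\mathbb R^4_1$ consisting of flat points, and suppose that the mean curvature vector $H$ at any point is a non-zero spacelike vector ($\langle H,H\rangle>0$) or a timelike vector ($\langle H,H\rangle<0$). Then either $M^2$ lies in a hyperplane of $\mathbb R^4_1$ or $M^2$ is part of a developable ruled surface in $\mathbb R^4_1$.
   Context: $\mathbb R^4_1$ is the four-dimensional Minkowski space with metric $\langle\,,\rangle$ of signature $(3,1)$, with a fixed orthonormal basis $e_1,e_2,e_3,e_4$, $e_1^2=e_2^2=e_3^2=1$, $e_4^2=-1$, giving the orientation. A surface $M^2: z=z(u,v)$, $(u,v)\in\mathcal D$ ($\mathcal D\subset\mathbb R^2$) is spacelike if $\langle\,,\rangle$ induces a Riemannian metric on it. Put $E=\langle z_u,z_u\rangle$, $F=\langle z_u,z_v\rangle$, $G=\langle z_v,z_v\rangle$, $W=\sqrt{EG-F^2}$. Choose a normal frame field $\{n_1,n_2\}$ with $\langle n_1,n_1\rangle=1$, $\langle n_2,n_2\rangle=-1$, $\langle n_1,n_2\rangle=0$, such that $\{z_u,z_v,n_1,n_2\}$ is positively oriented. Put $c_{11}^k=\langle z_{uu},n_k\rangle$, $c_{12}^k=\langle z_{uv},n_k\rangle$, $c_{22}^k=\langle z_{vv},n_k\rangle$ ($k=1,2$), $$\Delta_1=c_{11}^1c_{12}^2-c_{11}^2c_{12}^1,\quad \Delta_2=c_{11}^1c_{22}^2-c_{11}^2c_{22}^1,\quad \Delta_3=c_{12}^1c_{22}^2-c_{12}^2c_{22}^1,$$ $$L=\frac{2\Delta_1}{W},\quad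 M=\frac{\Delta_2}{W},\quad N=\frac{2\Delta_3}{W},\qquad k=\frac{LN-M^2}{EG-F^2},\quad \varkappa=\frac{EN+GL-2FM}{2(EG-F^2)}.$$ A point is flat if $k=\varkappa=0$ there (equivalently $L=M=N=0$); the surface consists of flat points if $k=\varkappa=0$ for all $(u,v)\in\mathcal D$. With $\sigma$ the second fundamental tensor (normal-bundle-valued) and $\{x,y\}$ an orthonormal tangent frame, the mean curvature vector is $H=\frac12(\sigma(x,x)+\sigma(y,y))$. A hyperplane is an affine three-dimensional subspace. A developable ruled surface is a surface swept out by a one-parameter family of straight lines (rulings) such that the tangent plane is constant along each ruling.
   Formalization: For smooth surfaces the dichotomy can fail where a region of zero Gauss curvature borders points of nonzero Gauss curvature; it is proved on every connected open part of the surface free of such points, and these points are shown to be nowhere dense. *)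

(* Defs.v *)
From Stdlib Require Import Reals.
From Coquelicot Require Import Coquelicot.
Open Scope R_scope.

(* Vectors carry Coquelicot's product structure: [plus], [minus], [scal] and
   [zero] are componentwise.  The fixed oriented basis e1, ..., e4 is the
   standard one, e4 being the timelike vector. *)
Notation R4 := (R * R * R * R)%type.

Definition x1 (x : R4) : R := fst (fst (fst x)).
Definition x2 (x : R4) : R := snd (fst (fst x)).
Definition x3 (x : R4) : R := snd (fst x).
Definition x4 (x : R4) : R := snd x.

Definition mink (x y : R4) : R :=
  x1 x * x1 y + x2 x * x2 y + x3 x * x3 y - x4 x * x4 y.

Definition det3 (a1 a2 a3 b1 b2 b3 c1 c2 c3 : R) : R :=
  a1 * (b2 * c3 - b3 * c2) - a2 * (b1 * c3 - b3 * c1)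
  + a3 * (b1 * c2 - b2 * c1).

Definition det4 (a b c d : R4) : R :=
  x1 a * det3 (x2 b) (x3 b) (x4 b) (x2 c) (x3 c) (x4 c) (x2 d) (x3 d) (x4 d)
  - x2 a * det3 (x1 b) (x3 b) (x4 b) (x1 c) (x3 c) (x4 c) (x1 d) (x3 d) (x4 d)
  + x3 a * det3 (x1 b) (x2 b) (x4 b) (x1 c) (x2 c) (x4 c) (x1 d) (x2 d) (x4 d)
  - x4 a * det3 (x1 b) (x2 b) (x3 b) (x1 c) (x2 c) (x3 c) (x1 d) (x2 d) (x3 d).

Definition lin_indep2 (a b : R4) : Prop :=
  forall s t : R, plus (scal s a) (scal t b) = zero -> s = 0 /\ t = 0.

Definition lin_indep3 (a b c : R4) : Prop :=
  forall r s t : R,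
    plus (plus (scal r a) (scal s b)) (scal t c) = zero ->
    r = 0 /\ s = 0 /\ t = 0.

Definition in_span2 (a b w : R4) : Prop :=
  exists s t : R, w = plus (scal s a) (scal t b).

(* Topology and smoothness *)

Definition connected (V : R * R -> Prop) : Prop :=
  forall A B : R * R -> Prop,
    open A -> open B ->
    (forall p, V p -> A p \/ B p) ->
    (exists p, V p /\ A p) -> (exists p, V p /\ B p) ->
    exists p, V p /\ A p /\ B p.

Definition smooth2 (V : R * R -> Prop) (f : R -> R -> R) : Prop :=
  forall u v : R, V (u, v) -> forall n : nat, ex_diff_n f n u v.

Definition smooth_field (V : R * R -> Prop) (f : R -> R -> R4) : Prop :=
  smooth2 V (fun u v => x1 (f u v)) /\ smooth2 V (fun u v => x2 (f u v)) /\
  smooth2 V (fun u v => x3 (f u v)) /\ smooth2 V (fun u v => x4 (f u v)).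

Definition smooth1 (a b : R) (f : R -> R) : Prop :=
  forall s : R, a < s < b -> forall n : nat, ex_derive_n f n s.

Definition smooth_curve (a b : R) (c : R -> R4) : Prop :=
  smooth1 a b (fun s => x1 (c s)) /\ smooth1 a b (fun s => x2 (c s)) /\
  smooth1 a b (fun s => x3 (c s)) /\ smooth1 a b (fun s => x4 (c s)).

Definition velocity (c : R -> R4) (s : R) : R4 :=
  (Derive (fun r => x1 (c r)) s, Derive (fun r => x2 (c r)) s,
   Derive (fun r => x3 (c r)) s, Derive (fun r => x4 (c r)) s).

Definition d_u (z : R -> R -> R4) (u v : R) : R4 := velocity (fun r => z r v) u.
Definition d_v (z : R -> R -> R4) (u v : R) : R4 := velocity (fun r => z u r) v.

(* First fundamental form *)

Definition EE (z : R -> R -> R4) (u v : R) : R := mink (d_u z u v) (d_u z u v).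
Definition FF (z : R -> R -> R4) (u v : R) : R := mink (d_u z u v) (d_v z u v).
Definition GG (z : R -> R -> R4) (u v : R) : R := mink (d_v z u v) (d_v z u v).
Definition WW (z : R -> R -> R4) (u v : R) : R :=
  sqrt (EE z u v * GG z u v - FF z u v * FF z u v).

Definition spacelike (D : R * R -> Prop) (z : R -> R -> R4) : Prop :=
  forall u v : R, D (u, v) ->
  forall a b : R, (a <> 0 \/ b <> 0) ->
    0 < EE z u v * a ^ 2 + 2 * FF z u v * a * b + GG z u v * b ^ 2.

(* Normal frame and second fundamental tensor *)

Definition normal_frame (D : R * R -> Prop) (z n1 n2 : R -> R -> R4) : Prop :=
  smooth_field D n1 /\ smooth_field D n2 /\
  forall u v : R, D (u, v) ->
    mink (n1 u v) (d_u z u v) = 0 /\ mink (n1 u v) (d_v z u v) = 0 /\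
    mink (n2 u v) (d_u z u v) = 0 /\ mink (n2 u v) (d_v z u v) = 0 /\
    mink (n1 u v) (n1 u v) = 1 /\ mink (n2 u v) (n2 u v) = -1 /\
    mink (n1 u v) (n2 u v) = 0 /\
    0 < det4 (d_u z u v) (d_v z u v) (n1 u v) (n2 u v).

(* With [n := n1] or [n := n2] these are the coefficients c_ij^1, c_ij^2. *)
Definition c11 (z n : R -> R -> R4) (u v : R) : R := mink (d_u (d_u z) u v) (n u v).
Definition c12 (z n : R -> R -> R4) (u v : R) : R := mink (d_v (d_u z) u v) (n u v).
Definition c22 (z n : R -> R -> R4) (u v : R) : R := mink (d_v (d_v z) u v) (n u v).

Definition Delta1 (z n1 n2 : R -> R -> R4) (u v : R) : R :=
  c11 z n1 u v * c12 z n2 u v - c11 z n2 u v * c12 z n1 u v.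
Definition Delta2 (z n1 n2 : R -> R -> R4) (u v : R) : R :=
  c11 z n1 u v * c22 z n2 u v - c11 z n2 u v * c22 z n1 u v.
Definition Delta3 (z n1 n2 : R -> R -> R4) (u v : R) : R :=
  c12 z n1 u v * c22 z n2 u v - c12 z n2 u v * c22 z n1 u v.

Definition LL (z n1 n2 : R -> R -> R4) (u v : R) : R :=
  2 * Delta1 z n1 n2 u v / WW z u v.
Definition MM (z n1 n2 : R -> R -> R4) (u v : R) : R :=
  Delta2 z n1 n2 u v / WW z u v.
Definition NN (z n1 n2 : R -> R -> R4) (u v : R) : R :=
  2 * Delta3 z n1 n2 u v / WW z u v.

Definition inv_k (z n1 n2 : R -> R -> R4) (u v : R) : R :=
  (LL z n1 n2 u v * NN z n1 n2 u v - MM z n1 n2 u v * MM z n1 n2 u v)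
  / (EE z u v * GG z u v - FF z u v * FF z u v).
Definition inv_kappa (z n1 n2 : R -> R -> R4) (u v : R) : R :=
  (EE z u v * NN z n1 n2 u v + GG z u v * LL z n1 n2 u v
   - 2 * FF z u v * MM z n1 n2 u v)
  / (2 * (EE z u v * GG z u v - FF z u v * FF z u v)).

Definition flat_point (z n1 n2 : R -> R -> R4) (u v : R) : Prop :=
  inv_k z n1 n2 u v = 0 /\ inv_kappa z n1 n2 u v = 0.

(* The minus sign is due to <n2, n2> = -1. *)
Definition normal_part (n1 n2 : R -> R -> R4) (u v : R) (w : R4) : R4 :=
  minus (scal (mink w (n1 u v)) (n1 u v)) (scal (mink w (n2 u v)) (n2 u v)).

(* A tangent vector is given by its coordinates: [x] stands for
   fst x * z_u + snd x * z_v. *)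
Definition tangent (z : R -> R -> R4) (u v : R) (x : R * R) : R4 :=
  plus (scal (fst x) (d_u z u v)) (scal (snd x) (d_v z u v)).

Definition sigma (z n1 n2 : R -> R -> R4) (u v : R) (x y : R * R) : R4 :=
  plus (plus
    (scal (fst x * fst y) (normal_part n1 n2 u v (d_u (d_u z) u v)))
    (scal (fst x * snd y + snd x * fst y)
          (normal_part n1 n2 u v (d_v (d_u z) u v))))
    (scal (snd x * snd y) (normal_part n1 n2 u v (d_v (d_v z) u v))).

Definition is_mean_curvature_vector (z n1 n2 : R -> R -> R4) (u v : R) (h : R4)
  : Prop :=
  exists x y : R * R,
    mink (tangent z u v x) (tangent z u v x) = 1 /\
    mink (tangent z u v y) (tangent z u v y) = 1 /\
    mink (tangent z u v x) (tangent z u v y) = 0 /\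
    h = scal (/ 2) (plus (sigma z n1 n2 u v x x) (sigma z n1 n2 u v y y)).

(* Gauss equation (the ambient space is flat). *)
Definition gauss_curvature (z n1 n2 : R -> R -> R4) (u v : R) : R :=
  (mink (sigma z n1 n2 u v (1, 0) (1, 0)) (sigma z n1 n2 u v (0, 1) (0, 1))
   - mink (sigma z n1 n2 u v (1, 0) (0, 1)) (sigma z n1 n2 u v (1, 0) (0, 1)))
  / (EE z u v * GG z u v - FF z u v * FF z u v).

(* Points at which a region of vanishing Gauss curvature borders on points of
   nonzero Gauss curvature.  They have to be set aside: a smooth surface can
   pass there from one alternative of the classification to the other.  With
   theta t = exp (- 1 / t) for t > 0 and theta t = 0 for t <= 0, the surface
     z (u, v) = (u, v, v ^ 2 + theta (- v) * u ^ 2, theta v)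
   near the origin is spacelike, consists of flat points and has spacelike
   mean curvature vector.  Its part v < 0 lies in the hyperplane x4 = 0, and in
   no other one, and has nonzero Gauss curvature; its part v > 0 is a cylinder
   which leaves that hyperplane.  A real-analytic surface over a connected
   domain has no such point, nor has one whose Gauss curvature vanishes
   identically or nowhere. *)
Definition type_changing (D : R * R -> Prop) (z n1 n2 : R -> R -> R4)
  (p : R * R) : Prop :=
  D p /\
  forall Q : R * R -> Prop, open Q -> Q p ->
    (exists u v : R, Q (u, v) /\ D (u, v) /\ gauss_curvature z n1 n2 u v <> 0) /\
    (exists O : R * R -> Prop, open O /\ (exists q, O q) /\
       forall u v : R, O (u, v) ->
         Q (u, v) /\ D (u, v) /\ gauss_curvature z n1 n2 u v = 0).

(* Hyperplanes *)

Definition in_hyperplane (q a b c x : R4) : Prop :=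
  exists r s t : R,
    x = plus q (plus (plus (scal r a) (scal s b)) (scal t c)).

Definition lies_in_hyperplane (V : R * R -> Prop) (z : R -> R -> R4) : Prop :=
  exists q a b c : R4, lin_indep3 a b c /\
    forall u v : R, V (u, v) -> in_hyperplane q a b c (z u v).

(* Developable ruled surfaces *)

(* The rulings are the whole lines { c s + t e s | t real }, a < s < b.  The
   swept surface may have singular points (such as the vertex of a cone or the
   edge of regression of a tangent developable), where it has no tangent plane. *)
Definition ruled (c e : R -> R4) (s t : R) : R4 := plus (c s) (scal t (e s)).

Definition regular_point (X : R -> R -> R4) (s t : R) : Prop :=
  lin_indep2 (d_u X s t) (d_v X s t).

Definition developable_ruled (a b : R) (c e : R -> R4) : Prop :=
  smooth_curve a b c /\ smooth_curve a b e /\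
  (forall s : R, a < s < b -> e s <> zero) /\
  forall s t t' : R, a < s < b ->
    regular_point (ruled c e) s t -> regular_point (ruled c e) s t' ->
    forall w : R4,
      in_span2 (d_u (ruled c e) s t) (d_v (ruled c e) s t) w <->
      in_span2 (d_u (ruled c e) s t') (d_v (ruled c e) s t') w.

(* [l] assigns to every point of the surface the direction of the ruling
   through it, so that there is a single family of rulings on the whole surface;
   near every point this is a smooth one-parameter family [c s + t e s].
   A single parametrization of all the rulings by one interval would be too much
   to ask: on a U-shaped or annular V the rulings need not be naturally
   parametrized by an interval.  For an immersion z the chain rule makes (s, t)
   local coordinates and all the points of the surface regular on [ruled c e]. *)
Definition part_of_developable_ruled_surface
  (V : R * R -> Prop) (z : R -> R -> R4) : Prop :=
  exists l : R -> R -> R4,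
  forall p : R * R, V p ->
  exists (Q : R * R -> Prop) (a b : R) (c e : R -> R4) (s t : R -> R -> R),
    open Q /\ Q p /\ (forall q, Q q -> V q) /\
    developable_ruled a b c e /\
    smooth2 Q s /\ smooth2 Q t /\
    forall u v : R, Q (u, v) ->
      a < s u v < b /\
      z u v = ruled c e (s u v) (t u v) /\
      exists m : R, e (s u v) = scal m (l u v).

(* Main.v *)
Require Import Defs.
From Stdlib Require Import Reals.
From Coquelicot Require Import Coquelicot.
From Stdlib Require Import Lra Classical ClassicalEpsilon.
Open Scope R_scope.

(** Two classical arguments meet here, and both rest on one device: differentiating an orthogonality
relation <a, n> = 0 in u and in v and equating the mixed derivatives gives exactly the
Codazzi equation that is needed, with no Christoffel symbols and no normal connection.

At a flat point the three determinants Delta1, Delta2, Delta3 vanish, so the two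
coefficient triples c_ij^1 and c_ij^2 are proportional: the second fundamental tensor
takes its values in the line of the mean curvature vector.  Writing
T_k = G c_11^k - 2 F c_12^k + E c_22^k (so that H is a multiple of T_1 n_1 - T_2 n_2),
the hypothesis on H says T_1^2 <> T_2^2, which gives c_ij^k = T_k s_ij for one symmetric
form s that is not zero ([shape_scalars]), and the Gauss curvature is a nonzero multiple
of det s.

Away from the type-changing points a connected piece V of the surface has Gauss
curvature either identically zero or nonzero on a dense subset
([curvature_dichotomy]).

If it is nonzero on a dense set, consider the normal field N = T_2 n_1 - T_1 n_2, which
is orthogonal to z_u, z_v and all second derivatives of z.  Hence N_u and N_v are normal,
and by Codazzi their components along H vanish wherever det s <> 0, so everywhere by
continuity ([d_binormal_mean_normal]).  The direction of N is thus constant, and V lies in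
a hyperplane orthogonal to it ([hyperplane_of_dense_curvature]).

If it is identically zero, s has rank one; after exchanging u and v, or n_1 and n_2, some
c_22 is nonzero.  Put xi = d/du + kappa d/dv with kappa = - c_12 / c_22, the null direction
of s, and let lambda = xi z.  Normalized by a fixed linear function, e = lambda / <lambda, l0>
satisfies xi e = 0 by Codazzi ([ruling_field_constant]); with t = <z - z0, l0> the point
z - t e is then also constant along xi ([foot_point_constant]).  So the integral curves of
xi lie on straight lines.  No differential equation has to be solved: a scalar component f
of z - t e has nonzero derivative across xi, its level curves are the integral curves, and
the implicit function theorem turns everything that xi annihilates into a smooth function of f
([level_coordinate]).  The tangent plane is constant along a ruling because the derivatives
of e and of z - t e are tangent to the surface. *)

(** * Calculus of smooth functions of two variables *)

Lemma open_locally_2d (V P : R * R -> Prop) (u v : R) :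
  open V -> V (u, v) -> (forall q, V q -> P q) ->
  locally_2d (fun x y => P (x, y)) u v.
Proof.
  intros HV Hp HP. apply locally_2d_locally.
  apply (filter_imp V); [intros [x y] Hq; exact (HP _ Hq) | exact (HV _ Hp)].
Qed.

Lemma open_locally_u (V : R * R -> Prop) (P : R -> Prop) (u v : R) :
  open V -> V (u, v) -> (forall r, V (r, v) -> P r) -> locally u P.
Proof.
  intros HV Hp HP. apply filter_imp with (P := fun r => V (r, v)); [exact HP|].
  apply (locally_2d_1d_const_y (fun x y => V (x, y))).
  apply open_locally_2d with V; auto.
Qed.

Lemma open_locally_v (V : R * R -> Prop) (P : R -> Prop) (u v : R) :
  open V -> V (u, v) -> (forall r, V (u, r) -> P r) -> locally v P.
Proof.
  intros HV Hp HP. apply filter_imp with (P := fun r => V (u, r)); [exact HP|].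
  apply (locally_2d_1d_const_x (fun x y => V (x, y))).
  apply open_locally_2d with V; auto.
Qed.

(** Smoothness of a fixed finite order, so that closure properties can be proved by
    induction on the order. *)
Definition diff_on (V : R * R -> Prop) (n : nat) (f : R -> R -> R) : Prop :=
  forall u v : R, V (u, v) -> ex_diff_n f n u v.

Lemma diff_on_ext (V : R * R -> Prop) (n : nat) (f g : R -> R -> R) :
  open V -> (forall u v, V (u, v) -> f u v = g u v) ->
  diff_on V n f -> diff_on V n g.
Proof.
  intros HV E Hf u v Hp. apply ex_diff_n_ext_loc with f; [|exact (Hf u v Hp)].
  apply (open_locally_2d V (fun q => f (fst q) (snd q) = g (fst q) (snd q))); auto.
  intros [x y]; exact (E x y).
Qed.

Lemma diff_on_S (V : R * R -> Prop) (n : nat) (f fu fv : R -> R -> R) :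
  open V ->
  (forall u v, V (u, v) -> continuity_2d_pt f u v) ->
  (forall u v, V (u, v) -> is_derive (fun r => f r v) u (fu u v)) ->
  (forall u v, V (u, v) -> is_derive (fun r => f u r) v (fv u v)) ->
  diff_on V n fu -> diff_on V n fv -> diff_on V (S n) f.
Proof.
  intros HV Hc Hu Hv Du Dv u v Hp. split; [auto|].
  split; [eexists; apply Hu; auto|]. split; [eexists; apply Hv; auto|]. split.
  - apply (diff_on_ext V n fu); auto.
    intros x y Hq. symmetry. apply is_derive_unique, Hu, Hq.
  - apply (diff_on_ext V n fv); auto.
    intros x y Hq. symmetry. apply is_derive_unique, Hv, Hq.
Qed.

Definition partial_u (f : R -> R -> R) (u v : R) : R := Derive (fun r => f r v) u.
Definition partial_v (f : R -> R -> R) (u v : R) : R := Derive (fun r => f u r) v.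

Lemma diff_on_inv_S (V : R * R -> Prop) (n : nat) (f : R -> R -> R) :
  diff_on V (S n) f ->
  (forall u v, V (u, v) -> continuity_2d_pt f u v) /\
  (forall u v, V (u, v) -> is_derive (fun r => f r v) u (partial_u f u v)) /\
  (forall u v, V (u, v) -> is_derive (fun r => f u r) v (partial_v f u v)) /\
  diff_on V n (partial_u f) /\ diff_on V n (partial_v f) /\ diff_on V n f.
Proof.
  intros Hf. split; [|split; [|split; [|split; [|split]]]]; intros u v Hp;
    pose proof (Hf u v Hp) as H; try (apply ex_diff_n_m with (S n); [auto|exact H]);
    destruct H as [H0 [H1 [H2 [H3 H4]]]]; auto.
  - now apply Derive_correct.
  - now apply Derive_correct.
Qed.

Lemma diff_on_plus (V : R * R -> Prop) (n : nat) : open V -> forall f g,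
  diff_on V n f -> diff_on V n g -> diff_on V n (fun u v => f u v + g u v).
Proof.
  intros HV. induction n as [|n IH]; intros f g Hf Hg.
  - intros u v Hp. destruct (Hf u v Hp) as [Cf _], (Hg u v Hp) as [Cg _].
    split; [now apply continuity_2d_pt_plus | exact I].
  - apply diff_on_inv_S in Hf; apply diff_on_inv_S in Hg.
    destruct Hf as [Cf [fu [fv [Df [Df' Df0]]]]], Hg as [Cg [gu [gv [Dg [Dg' Dg0]]]]].
    apply diff_on_S with (fun u v => partial_u f u v + partial_u g u v) (fun u v => partial_v f u v + partial_v g u v); auto.
    + intros; apply continuity_2d_pt_plus; auto.
    + intros u v Hp; apply (is_derive_plus (fun r => f r v) (fun r => g r v)); auto.
    + intros u v Hp; apply (is_derive_plus (fun r => f u r) (fun r => g u r)); auto.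
Qed.

Lemma diff_on_mult (V : R * R -> Prop) (n : nat) : open V -> forall f g,
  diff_on V n f -> diff_on V n g -> diff_on V n (fun u v => f u v * g u v).
Proof.
  intros HV. induction n as [|n IH]; intros f g Hf Hg.
  - intros u v Hp. destruct (Hf u v Hp) as [Cf _], (Hg u v Hp) as [Cg _].
    split; [now apply continuity_2d_pt_mult | exact I].
  - apply diff_on_inv_S in Hf; apply diff_on_inv_S in Hg.
    destruct Hf as [Cf [fu [fv [Df [Df' Df0]]]]], Hg as [Cg [gu [gv [Dg [Dg' Dg0]]]]].
    apply diff_on_S with (fun u v => partial_u f u v * g u v + f u v * partial_u g u v)
                         (fun u v => partial_v f u v * g u v + f u v * partial_v g u v);
      try (apply diff_on_plus); auto.
    + intros; apply continuity_2d_pt_mult; auto.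
    + intros u v Hp; apply (is_derive_mult (fun r => f r v) (fun r => g r v)); auto.
      intros; apply Rmult_comm.
    + intros u v Hp; apply (is_derive_mult (fun r => f u r) (fun r => g u r)); auto.
      intros; apply Rmult_comm.
Qed.

Lemma diff_on_const (V : R * R -> Prop) (n : nat) (k : R) :
  open V -> diff_on V n (fun _ _ => k).
Proof.
  intros HV. revert k; induction n as [|n IH]; intros k.
  - split; [apply continuity_2d_pt_const | exact I].
  - apply diff_on_S with (fun _ _ => 0) (fun _ _ => 0); auto; intros.
    + apply continuity_2d_pt_const.
    + apply (@is_derive_const R_AbsRing R_NormedModule).
    + apply (@is_derive_const R_AbsRing R_NormedModule).
Qed.

Lemma diff_on_inv (V : R * R -> Prop) (n : nat) (f : R -> R -> R) : open V ->
  (forall u v, V (u, v) -> f u v <> 0) ->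
  diff_on V n f -> diff_on V n (fun u v => / f u v).
Proof.
  intros HV H0. induction n as [|n IH]; intros Hf.
  - intros u v Hp. destruct (Hf u v Hp) as [Cf _].
    split; [apply continuity_2d_pt_inv; auto | exact I].
  - apply diff_on_inv_S in Hf. destruct Hf as [Cf [fu [fv [Df [Df' Df0]]]]].
    apply diff_on_S with (fun u v => -1 * partial_u f u v * (/ f u v * / f u v))
                         (fun u v => -1 * partial_v f u v * (/ f u v * / f u v));
      try (repeat apply diff_on_mult); auto using diff_on_const.
    + intros; apply continuity_2d_pt_inv; auto.
    + intros u v Hp.
      replace (-1 * partial_u f u v * (/ f u v * / f u v)) with (- partial_u f u v / (f u v) ^ 2)
        by (field; auto).
      apply (is_derive_inv (fun r => f r v)); auto.
    + intros u v Hp.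
      replace (-1 * partial_v f u v * (/ f u v * / f u v)) with (- partial_v f u v / (f u v) ^ 2)
        by (field; auto).
      apply (is_derive_inv (fun r => f u r)); auto.
Qed.

Section Smooth2.
Variable V : R * R -> Prop.
Hypothesis V_open : open V.

Lemma smooth2_diff_on (f : R -> R -> R) :
  smooth2 V f <-> forall n, diff_on V n f.
Proof. split; intros H; [intros n u v Hp | intros u v Hp n]; now apply H. Qed.

Lemma smooth2_plus f g : smooth2 V f -> smooth2 V g ->
  smooth2 V (fun u v => f u v + g u v).
Proof. rewrite !smooth2_diff_on; auto using diff_on_plus. Qed.

Lemma smooth2_mult f g : smooth2 V f -> smooth2 V g ->
  smooth2 V (fun u v => f u v * g u v).
Proof. rewrite !smooth2_diff_on; auto using diff_on_mult. Qed.

Lemma smooth2_const k : smooth2 V (fun _ _ => k).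
Proof. rewrite smooth2_diff_on; auto using diff_on_const. Qed.

Lemma smooth2_inv f : smooth2 V f -> (forall u v, V (u, v) -> f u v <> 0) ->
  smooth2 V (fun u v => / f u v).
Proof. rewrite !smooth2_diff_on; auto using diff_on_inv. Qed.

Lemma smooth2_opp f : smooth2 V f -> smooth2 V (fun u v => - f u v).
Proof.
  intros Hf. apply smooth2_diff_on. intros n.
  apply (diff_on_ext V n (fun u v => -1 * f u v)); [exact V_open | intros; ring |].
  apply smooth2_diff_on, smooth2_mult; [apply smooth2_const | exact Hf].
Qed.

Lemma smooth2_minus f g : smooth2 V f -> smooth2 V g ->
  smooth2 V (fun u v => f u v - g u v).
Proof. intros; apply smooth2_plus; [|apply smooth2_opp]; auto. Qed.

Lemma smooth2_div f g : smooth2 V f -> smooth2 V g ->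
  (forall u v, V (u, v) -> g u v <> 0) -> smooth2 V (fun u v => f u v / g u v).
Proof. intros; apply smooth2_mult; [|apply smooth2_inv]; auto. Qed.

Lemma smooth2_partial_u f : smooth2 V f -> smooth2 V (partial_u f).
Proof. intros H u v Hp n. exact (proj1 (proj2 (proj2 (proj2 (H u v Hp (S n)))))). Qed.

Lemma smooth2_partial_v f : smooth2 V f -> smooth2 V (partial_v f).
Proof. intros H u v Hp n. exact (proj2 (proj2 (proj2 (proj2 (H u v Hp (S n)))))). Qed.

Lemma smooth2_continuity f u v : smooth2 V f -> V (u, v) -> continuity_2d_pt f u v.
Proof. intros H Hp. exact (proj1 (H u v Hp 0%nat)). Qed.

Lemma smooth2_ex_derive_u f u v : smooth2 V f -> V (u, v) ->
  ex_derive (fun r => f r v) u.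
Proof. intros H Hp. exact (proj1 (proj2 (H u v Hp 1%nat))). Qed.

Lemma smooth2_ex_derive_v f u v : smooth2 V f -> V (u, v) ->
  ex_derive (fun r => f u r) v.
Proof. intros H Hp. exact (proj1 (proj2 (proj2 (H u v Hp 1%nat)))). Qed.

Lemma smooth2_schwarz f u v : smooth2 V f -> V (u, v) ->
  partial_v (partial_u f) u v = partial_u (partial_v f) u v.
Proof.
  intros Hf Hp. unfold partial_u, partial_v. symmetry. apply Schwarz.
  - apply (open_locally_2d V (fun q => 
      ex_derive (fun r => f r (snd q)) (fst q) /\ ex_derive (fun r => f (fst q) r) (snd q) /\
      ex_derive (fun r => partial_v f r (snd q)) (fst q) /\ ex_derive (fun r => partial_u f (fst q) r) (snd q)));
      auto.
    intros [x y] Hq; simpl. repeat split;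
      auto using smooth2_ex_derive_u, smooth2_ex_derive_v, smooth2_partial_u, smooth2_partial_v.
  - apply (smooth2_continuity (partial_u (partial_v f))); auto using smooth2_partial_u, smooth2_partial_v.
  - apply (smooth2_continuity (partial_v (partial_u f))); auto using smooth2_partial_u, smooth2_partial_v.
Qed.

Lemma smooth2_differentiable f u v : smooth2 V f -> V (u, v) ->
  differentiable_pt_lim f u v (partial_u f u v) (partial_v f u v).
Proof.
  intros Hf Hp. apply filterdiff_differentiable_pt_lim.
  apply is_derive_filterdiff with (dfx := partial_u f).
  - apply (filter_imp V); [|exact (V_open _ Hp)].
    intros [x y] Hq. apply Derive_correct; auto using smooth2_ex_derive_u.
  - apply Derive_correct; auto using smooth2_ex_derive_v.
  - apply continuity_2d_pt_filterlim, smooth2_continuity; auto using smooth2_partial_u.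
Qed.
End Smooth2.

(** * The implicit function theorem in the plane *)

(** Only continuity of g is assumed: differentiability of F at the point first shows
    that the increment of g is at most a multiple of that of its argument, and this makes
    the remainder term negligible. *)
Lemma is_derive_implicit (F : R -> R -> R) (g : R -> R) (x lx ly : R) :
  differentiable_pt_lim F x (g x) lx ly -> ly <> 0 ->
  (exists d, 0 < d /\ forall y, Rabs (y - x) < d -> F y (g y) = F x (g x)) ->
  (forall e, 0 < e -> exists d, 0 < d /\
     forall y, Rabs (y - x) < d -> Rabs (g y - g x) < e) ->
  is_derive g x (- lx / ly).
Proof.
  intros HF Hly [d0 [Hd0 Hc]] Hg. apply is_derive_Reals.
  intros eps Heps.
  assert (Lp : 0 < Rabs ly) by (apply Rabs_pos_lt; exact Hly).
  pose proof (Rabs_pos lx) as Lx.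
  set (C := 2 + 2 * Rabs lx / Rabs ly).
  assert (HC : 0 < C).
  { unfold C. assert (0 <= 2 * Rabs lx / Rabs ly); [|lra].
    apply Rmult_le_pos; [lra|]. left; now apply Rinv_0_lt_compat. }
  (* The first bound controls the increment of g by (C - 1) |h|, the second one then makes
     the remainder at most eps / 2 after division by ly h. *)
  set (e := Rmin (Rabs ly / 2) (eps * Rabs ly / (2 * C))).
  assert (He : 0 < e).
  { unfold e. apply Rmin_glb_lt; [lra|]. apply Rdiv_lt_0_compat; nra. }
  destruct (HF (mkposreal e He)) as [d1 H1]; simpl in H1.
  destruct (Hg d1 (cond_pos d1)) as [d2 [Hd2 H2]].
  assert (Hd : 0 < Rmin d0 (Rmin d1 d2)).
  { repeat apply Rmin_glb_lt; auto. apply cond_pos. }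
  exists (mkposreal _ Hd). intros h Hh0 Hh; simpl in Hh.
  assert (Hh' : Rabs h < d0 /\ Rabs h < d1 /\ Rabs h < d2).
  { pose proof (Rmin_l d0 (Rmin d1 d2)); pose proof (Rmin_r d0 (Rmin d1 d2)).
    pose proof (Rmin_l d1 d2); pose proof (Rmin_r d1 d2). repeat split; lra. }
  assert (Eh : x + h - x = h) by ring.
  specialize (H1 (x + h) (g (x + h))). rewrite Eh in H1.
  specialize (H2 (x + h)). rewrite Eh in H2.
  specialize (Hc (x + h)). rewrite Eh in Hc.
  specialize (H1 (proj1 (proj2 Hh')) (H2 (proj2 (proj2 Hh')))).
  rewrite (Hc (proj1 Hh')) in H1.
  set (k := g (x + h) - g x) in *.
  replace (F x (g x) - F x (g x) - (lx * h + ly * k)) with (- (lx * h + ly * k)) in H1 by ring.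
  rewrite Rabs_Ropp in H1.
  assert (Ph : 0 < Rabs h) by (apply Rabs_pos_lt; exact Hh0).
  pose proof (Rabs_pos k) as Pk.
  assert (Hmax : Rmax (Rabs h) (Rabs k) <= Rabs h + Rabs k) by (apply Rmax_lub; lra).
  assert (E1 : e <= Rabs ly / 2) by apply Rmin_l.
  assert (E2 : e <= eps * Rabs ly / (2 * C)) by apply Rmin_r.
  assert (H3 : Rabs (lx * h + ly * k) <= e * (Rabs h + Rabs k)) by nra.
  assert (K : Rabs k <= (C - 1) * Rabs h).
  { assert (T : Rabs (ly * k) <= Rabs (lx * h + ly * k) + Rabs (lx * h)).
    { replace (ly * k) with ((lx * h + ly * k) + - (lx * h)) at 1 by ring.
      eapply Rle_trans; [apply Rabs_triang|]. rewrite Rabs_Ropp; lra. }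
    rewrite !Rabs_mult in T.
    assert (T2 : Rabs ly * Rabs k <= Rabs ly * ((C - 1) * Rabs h)).
    { replace (Rabs ly * ((C - 1) * Rabs h)) with ((Rabs ly + 2 * Rabs lx) * Rabs h)
        by (unfold C; field; lra).
      nra. }
    apply Rmult_le_reg_l with (Rabs ly); lra. }
  replace (k / h - - lx / ly) with ((lx * h + ly * k) / (ly * h)) by (field; auto).
  unfold Rdiv. rewrite Rabs_mult, Rabs_inv, Rabs_mult.
  apply Rmult_lt_reg_r with (Rabs ly * Rabs h); [nra|].
  rewrite Rmult_assoc, Rinv_l by (apply Rgt_not_eq; nra). rewrite Rmult_1_r.
  apply Rle_lt_trans with (e * (C * Rabs h)); [nra|].
  apply Rle_lt_trans with (eps * Rabs ly / (2 * C) * (C * Rabs h)).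
  { apply Rmult_le_compat_r; nra. }
  replace (eps * Rabs ly / (2 * C) * (C * Rabs h)) with (eps * (Rabs ly * Rabs h) / 2)
    by (field; lra).
  assert (0 < eps * (Rabs ly * Rabs h)) by (repeat apply Rmult_lt_0_compat; auto). lra.
Qed.

Lemma increasing_of_partial_v (V : R * R -> Prop) (f : R -> R -> R) (u x y : R) :
  smooth2 V f -> (forall v, x <= v <= y -> V (u, v)) ->
  (forall v, x <= v <= y -> 0 < partial_v f u v) -> x < y -> f u x < f u y.
Proof.
  intros Hf HV Hp Hxy.
  assert (Hd : forall v, x <= v <= y -> is_derive (fun r => f u r) v (partial_v f u v)).
  { intros v Hv. apply Derive_correct. apply smooth2_ex_derive_v with V; auto. }
  destruct (MVT_gen (fun r => f u r) x y (fun v => partial_v f u v)) as [c [Hc E]].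
  - rewrite Rmin_left, Rmax_right by lra. intros; apply Hd; lra.
  - rewrite Rmin_left, Rmax_right by lra. intros v Hv.
    apply derivable_continuous_pt. exists (partial_v f u v). apply is_derive_Reals, Hd, Hv.
  - rewrite Rmin_left, Rmax_right in Hc by lra.
    specialize (Hp c Hc). nra.
Qed.

Lemma continuity_2d_pt_u (f : R -> R -> R) (u v : R) : continuity_2d_pt f u v ->
  forall e, 0 < e -> exists d, 0 < d /\
    forall r, Rabs (r - u) < d -> Rabs (f r v - f u v) < e.
Proof.
  intros H e He. destruct (H (mkposreal e He)) as [d Hd].
  exists d. split; [apply cond_pos|]. intros r Hr. apply Hd; [exact Hr|].
  rewrite Rminus_diag, Rabs_R0; apply cond_pos.
Qed.

Section ImplicitFunction.
Variables (V : R * R -> Prop) (f : R -> R -> R) (u0 v0 : R).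
Hypotheses (V_open : open V) (f_smooth : smooth2 V f) (V0 : V (u0, v0))
  (f_incr : forall u v, V (u, v) -> 0 < partial_v f u v).

(** The solution g u w of f u v = w.  Differentiability in w serves to parametrize a
    transversal curve, differentiability in u to move along a level curve of f. *)
Lemma implicit_function : exists (d e : R) (g : R -> R -> R),
  0 < d /\ 0 < e /\
  (forall u w, Rabs (u - u0) < d -> Rabs (w - f u0 v0) < e ->
     V (u, g u w) /\ f u (g u w) = w /\
     is_derive (fun r => g r w) u (- partial_u f u (g u w) / partial_v f u (g u w)) /\
     is_derive (fun r => g u r) w (/ partial_v f u (g u w))) /\
  exists Q : R * R -> Prop, open Q /\ Q (u0, v0) /\
    forall u v, Q (u, v) -> V (u, v) /\ Rabs (u - u0) < d /\
      Rabs (f u v - f u0 v0) < e /\ g u (f u v) = v.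
Proof.
  destruct (open_locally_2d V V u0 v0 V_open V0 (fun q Hq => Hq)) as [r0 Hbox].
  pose proof (cond_pos r0) as Hr0. set (b := r0 / 2).
  assert (Hb : 0 < b < r0) by (unfold b; lra).
  assert (Vbox : forall u v, Rabs (u - u0) < r0 -> v0 - b <= v <= v0 + b -> V (u, v)).
  { intros u v Hu Hv. apply Hbox; [exact Hu|].
    apply Rabs_def1; lra. }
  assert (mono : forall u x y, Rabs (u - u0) < r0 -> v0 - b <= x -> y <= v0 + b ->
            x < y -> f u x < f u y).
  { intros u x y Hu Hx Hy Hxy. apply (increasing_of_partial_v V); auto.
    - intros v Hv. apply Vbox; [exact Hu | lra].
    - intros v Hv. apply f_incr, Vbox; [exact Hu | lra]. }
  assert (Z0 : Rabs (u0 - u0) < r0) by (rewrite Rminus_diag, Rabs_R0; lra).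
  set (w0 := f u0 v0).
  assert (Hlo : f u0 (v0 - b) < w0) by (apply mono; lra).
  assert (Hhi : w0 < f u0 (v0 + b)) by (apply mono; lra).
  set (e := Rmin (w0 - f u0 (v0 - b)) (f u0 (v0 + b) - w0) / 2).
  assert (He : 0 < e /\ 2 * e <= w0 - f u0 (v0 - b) /\ 2 * e <= f u0 (v0 + b) - w0).
  { pose proof (Rmin_l (w0 - f u0 (v0 - b)) (f u0 (v0 + b) - w0)).
    pose proof (Rmin_r (w0 - f u0 (v0 - b)) (f u0 (v0 + b) - w0)).
    assert (0 < Rmin (w0 - f u0 (v0 - b)) (f u0 (v0 + b) - w0)) by (apply Rmin_glb_lt; lra).
    unfold e; lra. }
  destruct He as [He [He1 He2]].
  assert (cont : forall u v, Rabs (u - u0) < r0 -> v0 - b <= v <= v0 + b ->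
            continuity_2d_pt f u v).
  { intros u v Hu Hv. apply smooth2_continuity with V; auto. }
  destruct (continuity_2d_pt_u f u0 (v0 - b) (cont u0 (v0 - b) Z0 ltac:(lra)) e He) as [d1 [Hd1 C1]].
  destruct (continuity_2d_pt_u f u0 (v0 + b) (cont u0 (v0 + b) Z0 ltac:(lra)) e He) as [d2 [Hd2 C2]].
  set (d := Rmin r0 (Rmin d1 d2)).
  assert (Hd : 0 < d /\ d <= r0 /\ d <= d1 /\ d <= d2).
  { pose proof (Rmin_l r0 (Rmin d1 d2)); pose proof (Rmin_r r0 (Rmin d1 d2)).
    pose proof (Rmin_l d1 d2); pose proof (Rmin_r d1 d2).
    assert (0 < d) by (repeat apply Rmin_glb_lt; lra).
    unfold d in *. repeat split; lra. }
  destruct Hd as [Hd [Hdr [Hdd1 Hdd2]]].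
  assert (sol : forall u w, Rabs (u - u0) < d -> Rabs (w - w0) < e ->
            exists v, v0 - b < v < v0 + b /\ f u v = w).
  { intros u w Hu Hw.
    specialize (C1 u ltac:(lra)). specialize (C2 u ltac:(lra)).
    apply Rabs_def2 in C1, C2, Hw.
    destruct (Ranalysis5.IVT_interv (fun v => f u v - w) (v0 - b) (v0 + b)) as [v [Hv E]].
    - intros v Hv. apply continuity_pt_minus; [|apply continuity_pt_const; intros ? ?; reflexivity].
      apply derivable_continuous_pt. exists (partial_v f u v). apply is_derive_Reals, Derive_correct.
      apply smooth2_ex_derive_v with V; auto. apply Vbox; [lra | exact Hv].
    - lra.
    - lra.
    - lra.
    - exists v. split; [|lra].
      assert (v <> v0 - b) by (intros ->; lra).
      assert (v <> v0 + b) by (intros ->; lra). lra. }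
  set (g := fun u w => epsilon (inhabits 0) (fun v => v0 - b < v < v0 + b /\ f u v = w)).
  assert (gP : forall u w, Rabs (u - u0) < d -> Rabs (w - w0) < e ->
            v0 - b < g u w < v0 + b /\ f u (g u w) = w).
  { intros u w Hu Hw. unfold g. apply epsilon_spec, sol; auto. }
  assert (below : forall u x y, Rabs (u - u0) < r0 -> v0 - b <= x <= v0 + b ->
            v0 - b <= y <= v0 + b -> f u x < f u y -> x < y).
  { intros u x y Hu Hx Hy Hlt. destruct (Rlt_le_dec x y) as [|Hle]; [assumption|].
    destruct Hle as [Hle | ->]; [|lra].
    pose proof (mono u y x Hu ltac:(lra) ltac:(lra) Hle). lra. }
  assert (gC : forall u w, Rabs (u - u0) < d -> Rabs (w - w0) < e ->
            forall eta, 0 < eta -> exists dl, 0 < dl /\ forall u' w', Rabs (u' - u) < dl ->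
              Rabs (w' - w) < dl -> Rabs (u' - u0) < d -> Rabs (w' - w0) < e ->
              Rabs (g u' w' - g u w) < eta).
  { intros u w Hu Hw eta Heta. destruct (gP u w Hu Hw) as [G1 G2].
    set (h := Rmin eta (Rmin (g u w - (v0 - b)) (v0 + b - g u w)) / 2).
    assert (Hh : 0 < h /\ h < eta /\ h < g u w - (v0 - b) /\ h < v0 + b - g u w).
    { pose proof (Rmin_l eta (Rmin (g u w - (v0 - b)) (v0 + b - g u w))).
      pose proof (Rmin_r eta (Rmin (g u w - (v0 - b)) (v0 + b - g u w))).
      pose proof (Rmin_l (g u w - (v0 - b)) (v0 + b - g u w)).
      pose proof (Rmin_r (g u w - (v0 - b)) (v0 + b - g u w)).
      assert (0 < Rmin eta (Rmin (g u w - (v0 - b)) (v0 + b - g u w)))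
        by (repeat apply Rmin_glb_lt; lra).
      unfold h; lra. }
    destruct Hh as [Hh0 [Hh1 [Hh2 Hh3]]].
    assert (Hur : Rabs (u - u0) < r0) by lra.
    pose proof (mono u (g u w - h) (g u w) Hur ltac:(lra) ltac:(lra) ltac:(lra)) as M1.
    pose proof (mono u (g u w) (g u w + h) Hur ltac:(lra) ltac:(lra) ltac:(lra)) as M2.
    rewrite G2 in M1, M2.
    set (k := Rmin (w - f u (g u w - h)) (f u (g u w + h) - w) / 2).
    assert (Hk : 0 < k /\ 2 * k <= w - f u (g u w - h) /\ 2 * k <= f u (g u w + h) - w).
    { pose proof (Rmin_l (w - f u (g u w - h)) (f u (g u w + h) - w)).
      pose proof (Rmin_r (w - f u (g u w - h)) (f u (g u w + h) - w)).
      assert (0 < Rmin (w - f u (g u w - h)) (f u (g u w + h) - w)) by (apply Rmin_glb_lt; lra).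
      unfold k; lra. }
    destruct Hk as [Hk [Hk1 Hk2]].
    destruct (continuity_2d_pt_u f u (g u w - h) (cont u (g u w - h) Hur ltac:(lra)) k Hk) as [l1 [Hl1 D1]].
    destruct (continuity_2d_pt_u f u (g u w + h) (cont u (g u w + h) Hur ltac:(lra)) k Hk) as [l2 [Hl2 D2]].
    exists (Rmin k (Rmin l1 l2)). split; [repeat apply Rmin_glb_lt; lra|].
    intros u' w' Hu' Hw' Hu'' Hw''.
    pose proof (Rmin_l k (Rmin l1 l2)); pose proof (Rmin_r k (Rmin l1 l2)).
    pose proof (Rmin_l l1 l2); pose proof (Rmin_r l1 l2).
    specialize (D1 u' ltac:(lra)). specialize (D2 u' ltac:(lra)).
    destruct (gP u' w' Hu'' Hw'') as [G3 G4].
    assert (Hw3 : Rabs (w' - w) < k) by lra.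
    apply Rabs_def2 in D1, D2, Hw3.
    assert (g u w - h < g u' w') by (apply (below u'); lra).
    assert (g u' w' < g u w + h) by (apply (below u'); lra).
    apply Rabs_def1; lra. }
  exists d, e, g. split; [exact Hd|]. split; [exact He|]. split.
  - intros u w Hu Hw. destruct (gP u w Hu Hw) as [G1 G2].
    assert (HV : V (u, g u w)) by (apply Vbox; lra).
    pose proof (f_incr u (g u w) HV) as Hpos.
    split; [exact HV|]. split; [exact G2|].
    pose proof (smooth2_differentiable V V_open f u (g u w) f_smooth HV) as Df. split.
    + apply (is_derive_implicit f (fun r => g r w)); [exact Df | lra | |].
      * exists (d - Rabs (u - u0)). split; [lra|]. intros y Hy.
        assert (Hy' : Rabs (y - u0) < d).
        { replace (y - u0) with ((y - u) + (u - u0)) by ring.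
          eapply Rle_lt_trans; [apply Rabs_triang | lra]. }
        rewrite G2. apply (gP y w Hy' Hw).
      * intros eta Heta. destruct (gC u w Hu Hw eta Heta) as [dl [Hdl HC]].
        exists (Rmin dl (d - Rabs (u - u0))). split; [apply Rmin_glb_lt; lra|].
        intros y Hy. pose proof (Rmin_l dl (d - Rabs (u - u0))).
        pose proof (Rmin_r dl (d - Rabs (u - u0))).
        apply HC; try lra; [rewrite Rminus_diag, Rabs_R0; lra|].
        replace (y - u0) with ((y - u) + (u - u0)) by ring.
        eapply Rle_lt_trans; [apply Rabs_triang | lra].
    + replace (/ partial_v f u (g u w)) with (- (0 - 1) / partial_v f u (g u w)) by (field; lra).
      apply (is_derive_implicit (fun x y => f u y - x) (fun r => g u r)); [ | lra | |].
      * intros eps. destruct (Df eps) as [dl Hdl]. exists dl. intros x y Hx Hy.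
        specialize (Hdl u y ltac:(rewrite Rminus_diag, Rabs_R0; apply cond_pos) Hy).
        rewrite Rminus_diag, Rabs_R0, Rmax_right in Hdl by apply Rabs_pos.
        replace (f u y - x - (f u (g u w) - w) - ((0 - 1) * (x - w) + partial_v f u (g u w) * (y - g u w)))
          with (f u y - f u (g u w) - (partial_u f u (g u w) * 0 + partial_v f u (g u w) * (y - g u w))) by ring.
        eapply Rle_trans; [exact Hdl|]. apply Rmult_le_compat_l; [left; apply cond_pos | apply Rmax_r].
      * exists (e - Rabs (w - w0)). split; [lra|]. intros y Hy.
        assert (Hy' : Rabs (y - w0) < e).
        { replace (y - w0) with ((y - w) + (w - w0)) by ring.
          eapply Rle_lt_trans; [apply Rabs_triang | lra]. }
        rewrite G2. destruct (gP u y Hu Hy') as [_ ->]. ring.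
      * intros eta Heta. destruct (gC u w Hu Hw eta Heta) as [dl [Hdl HC]].
        exists (Rmin dl (e - Rabs (w - w0))). split; [apply Rmin_glb_lt; lra|].
        intros y Hy. pose proof (Rmin_l dl (e - Rabs (w - w0))).
        pose proof (Rmin_r dl (e - Rabs (w - w0))).
        apply HC; try lra; [rewrite Rminus_diag, Rabs_R0; lra|].
        replace (y - w0) with ((y - w) + (w - w0)) by ring.
        eapply Rle_lt_trans; [apply Rabs_triang | lra].
  - set (P := fun q : R * R => Rabs (fst q - u0) < d /\ v0 - b < snd q < v0 + b /\
                Rabs (f (fst q) (snd q) - w0) < e).
    (* The interior of P is open by definition, whereas P itself need not be shown open. *)
    exists (fun q => locally q P). split; [|split].
    + intros q Hq. now apply locally_locally.
    + apply (locally_2d_locally (fun x y => P (x, y))).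
      destruct (cont u0 v0 Z0 ltac:(lra) (mkposreal e He)) as [l Hl].
      assert (Hm : 0 < Rmin l (Rmin d b)).
      { repeat apply Rmin_glb_lt; try lra. apply cond_pos. }
      exists (mkposreal _ Hm); simpl. intros x y Hx Hy.
      pose proof (Rmin_l l (Rmin d b)); pose proof (Rmin_r l (Rmin d b)).
      pose proof (Rmin_l d b); pose proof (Rmin_r d b).
      unfold P; simpl. split; [lra|]. split.
      * assert (Hy' : Rabs (y - v0) < b) by lra. apply Rabs_def2 in Hy'. lra.
      * apply Hl; lra.
    + intros u v Hq. apply locally_singleton in Hq. destruct Hq as [Hu [Hv Hw]]; simpl in *.
      split; [apply Vbox; lra|]. split; [exact Hu|]. split; [exact Hw|].
      destruct (gP u (f u v) Hu Hw) as [G1 G2].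
      destruct (Rtotal_order (g u (f u v)) v) as [Hlt | [E | Hgt]]; [|exact E|].
      * pose proof (mono u (g u (f u v)) v ltac:(lra) ltac:(lra) ltac:(lra) Hlt). lra.
      * pose proof (mono u v (g u (f u v)) ltac:(lra) ltac:(lra) ltac:(lra) Hgt). lra.
Qed.
End ImplicitFunction.

(** * Functions that are constant on level curves *)

Section LevelCoordinate.
Variables (V : R * R -> Prop) (f : R -> R -> R) (u0 v0 : R).
Hypotheses (V_open : open V) (f_smooth : smooth2 V f) (V0 : V (u0, v0))
  (f_incr : forall u v, V (u, v) -> 0 < partial_v f u v).

(** Along the line u = u0, parametrized by the value w of f, differentiating h in w
    means applying the operator h -> (partial_v h) / (partial_v f), which maps smooth
    functions to smooth functions.  Smoothness of every order follows at once. *)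
Lemma smooth1_transversal (a b : R) (gam : R -> R) (h : R -> R -> R) :
  (forall w, a < w < b -> V (u0, gam w) /\ is_derive gam w (/ partial_v f u0 (gam w))) ->
  smooth2 V h ->
  smooth1 a b (fun w => h u0 (gam w)) /\
  forall w, a < w < b ->
    Derive (fun r => h u0 (gam r)) w = partial_v h u0 (gam w) / partial_v f u0 (gam w).
Proof.
  intros Hg Hh.
  assert (D1 : forall h, smooth2 V h -> forall w, a < w < b ->
            is_derive (fun r => h u0 (gam r)) w (partial_v h u0 (gam w) / partial_v f u0 (gam w))).
  { intros k Hk w Hw. destruct (Hg w Hw) as [HV Hd].
    replace (partial_v k u0 (gam w) / partial_v f u0 (gam w)) with (/ partial_v f u0 (gam w) * partial_v k u0 (gam w))
      by (unfold Rdiv; ring).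
    apply (is_derive_comp (fun v => k u0 v) gam); [|exact Hd].
    apply Derive_correct. apply smooth2_ex_derive_v with V; auto. }
  assert (Dn : forall n h, smooth2 V h -> exists hn, smooth2 V hn /\
            forall w, a < w < b -> Derive_n (fun r => h u0 (gam r)) n w = hn u0 (gam w)).
  { induction n as [|n IH]; intros k Hk.
    - exists k. split; [exact Hk | reflexivity].
    - destruct (IH k Hk) as [kn [Hkn E]].
      exists (fun u v => partial_v kn u v / partial_v f u v). split.
      + apply smooth2_div; auto using smooth2_partial_v.
        intros u v Hp. specialize (f_incr u v Hp). lra.
      + intros w Hw. simpl. erewrite Derive_ext_loc; [apply is_derive_unique, D1; eauto|].
        apply (locally_interval _ w a b); try easy. intros y Ha Hb. apply E; easy. }
  split.
  - intros w Hw [|n]; [exact I|]. simpl. destruct (Dn n h Hh) as [hn [Hhn E]].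
    eapply ex_derive_ext_loc; [|eexists; apply (D1 hn Hhn w Hw)].
    apply (locally_interval _ w a b); try easy. intros y Ha Hb. symmetry. apply E; easy.
  - intros w Hw. apply is_derive_unique, D1; auto.
Qed.

(** If h and f are functionally dependent then h is constant along the level curves of f;
    following such a curve up to the line u = u0 writes h as a function of f. *)
Lemma level_coordinate : exists (a b : R) (gam : R -> R) (Q : R * R -> Prop),
  (forall w, a < w < b -> V (u0, gam w)) /\
  open Q /\ Q (u0, v0) /\ (forall u v, Q (u, v) -> V (u, v) /\ a < f u v < b) /\
  forall h, smooth2 V h ->
    smooth1 a b (fun w => h u0 (gam w)) /\
    (forall w, a < w < b ->
       Derive (fun r => h u0 (gam r)) w = partial_v h u0 (gam w) / partial_v f u0 (gam w)) /\
    ((forall u v, V (u, v) -> partial_u h u v * partial_v f u v = partial_v h u v * partial_u f u v) ->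
     forall u v, Q (u, v) -> h u v = h u0 (gam (f u v))).
Proof.
  destruct (implicit_function V f u0 v0 V_open f_smooth V0 f_incr)
    as [d [e [g [Hd [He [Hg [Q [HQ [Q0 HQ']]]]]]]]].
  assert (Z0 : Rabs (u0 - u0) < d) by (rewrite Rminus_diag, Rabs_R0; lra).
  assert (Hw : forall w, f u0 v0 - e < w < f u0 v0 + e -> Rabs (w - f u0 v0) < e).
  { intros w Hw; apply Rabs_def1; lra. }
  exists (f u0 v0 - e), (f u0 v0 + e), (g u0), Q.
  split; [|split; [exact HQ | split; [exact Q0 | split]]].
  - intros w H. apply (Hg u0 w Z0 (Hw w H)).
  - intros u v Hq. destruct (HQ' u v Hq) as [HV [_ [H _]]]. split; [exact HV|].
    apply Rabs_def2 in H; lra.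
  - intros h Hh.
    destruct (smooth1_transversal (f u0 v0 - e) (f u0 v0 + e) (g u0) h) as [S1 S2]; auto.
    { intros w H. destruct (Hg u0 w Z0 (Hw w H)) as [H1 [_ [_ H2]]]. now split. }
    split; [exact S1|]. split; [exact S2|].
    intros HJ u v Hq. destruct (HQ' u v Hq) as [HV [Hu [Hw' E]]].
    set (w := f u v) in *. rewrite <- E at 1.
    assert (Hder : forall r, Rabs (r - u0) < d -> is_derive (fun r => h r (g r w)) r 0).
    { intros r Hr. destruct (Hg r w Hr Hw') as [HVr [_ [Hdr _]]].
      pose proof (f_incr _ _ HVr) as Hpos.
      apply is_derive_Reals.
      replace 0 with (partial_u h r (g r w) * 1 + partial_v h r (g r w) * (- partial_u f r (g r w) / partial_v f r (g r w))).
      - apply (derivable_pt_lim_comp_2d h (fun x => x) (fun x => g x w)).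
        + apply (smooth2_differentiable V); auto.
        + apply derivable_pt_lim_id.
        + now apply is_derive_Reals.
      - apply Rmult_eq_reg_r with (partial_v f r (g r w)); [|lra].
        rewrite Rmult_0_l.
        transitivity (partial_u h r (g r w) * partial_v f r (g r w) - partial_v h r (g r w) * partial_u f r (g r w));
          [field; lra | rewrite HJ by exact HVr; ring]. }
    destruct (MVT_gen (fun r => h r (g r w)) u0 u (fun _ => 0)) as [c [_ Ec]].
    + intros r Hr. apply Hder.
      revert Hr; unfold Rmin, Rmax; destruct (Rle_dec u0 u); intros; apply Rabs_def2 in Hu;
        apply Rabs_def1; lra.
    + intros r Hr. apply derivable_continuous_pt. exists 0. apply is_derive_Reals, Hder.
      revert Hr; unfold Rmin, Rmax; destruct (Rle_dec u0 u); intros; apply Rabs_def2 in Hu;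
        apply Rabs_def1; lra.
    + lra.
Qed.
End LevelCoordinate.

(** * Linear algebra of Minkowski space *)

Lemma R4_ext (a b : R4) : x1 a = x1 b -> x2 a = x2 b -> x3 a = x3 b -> x4 a = x4 b -> a = b.
Proof.
  destruct a as [[[a1 a2] a3] a4], b as [[[b1 b2] b3] b4]; unfold x1, x2, x3, x4; simpl.
  now intros -> -> -> ->.
Qed.

(** The vector operations are componentwise only up to conversion; simplification would
    also unfold the canonical structures of the factors. *)
Ltac to_components :=
  repeat match goal with
  | |- context [x1 (plus ?a ?b)] => change (x1 (plus a b)) with (x1 a + x1 b)
  | |- context [x2 (plus ?a ?b)] => change (x2 (plus a b)) with (x2 a + x2 b)
  | |- context [x3 (plus ?a ?b)] => change (x3 (plus a b)) with (x3 a + x3 b)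
  | |- context [x4 (plus ?a ?b)] => change (x4 (plus a b)) with (x4 a + x4 b)
  | |- context [x1 (minus ?a ?b)] => change (x1 (minus a b)) with (x1 a - x1 b)
  | |- context [x2 (minus ?a ?b)] => change (x2 (minus a b)) with (x2 a - x2 b)
  | |- context [x3 (minus ?a ?b)] => change (x3 (minus a b)) with (x3 a - x3 b)
  | |- context [x4 (minus ?a ?b)] => change (x4 (minus a b)) with (x4 a - x4 b)
  | |- context [x1 (scal ?s ?b)] => change (x1 (scal s b)) with (s * x1 b)
  | |- context [x2 (scal ?s ?b)] => change (x2 (scal s b)) with (s * x2 b)
  | |- context [x3 (scal ?s ?b)] => change (x3 (scal s b)) with (s * x3 b)
  | |- context [x4 (scal ?s ?b)] => change (x4 (scal s b)) with (s * x4 b)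
  | |- context [x1 zero] => change (x1 zero) with 0
  | |- context [x2 zero] => change (x2 zero) with 0
  | |- context [x3 zero] => change (x3 zero) with 0
  | |- context [x4 zero] => change (x4 zero) with 0
  end.

Lemma mink_sym (a b : R4) : mink a b = mink b a.
Proof. unfold mink; ring. Qed.
Lemma mink_plus_l (a b c : R4) : mink (plus a b) c = mink a c + mink b c.
Proof. unfold mink; to_components; ring. Qed.
Lemma mink_minus_l (a b c : R4) : mink (minus a b) c = mink a c - mink b c.
Proof. unfold mink; to_components; ring. Qed.
Lemma mink_scal_l (s : R) (a c : R4) : mink (scal s a) c = s * mink a c.
Proof. unfold mink; to_components; ring. Qed.
Lemma mink_plus_r (a b c : R4) : mink c (plus a b) = mink c a + mink c b.
Proof. unfold mink; to_components; ring. Qed.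
Lemma mink_minus_r (a b c : R4) : mink c (minus a b) = mink c a - mink c b.
Proof. unfold mink; to_components; ring. Qed.
Lemma mink_scal_r (s : R) (a c : R4) : mink c (scal s a) = s * mink c a.
Proof. unfold mink; to_components; ring. Qed.
Lemma mink_zero_l (a : R4) : mink zero a = 0.
Proof. unfold mink; to_components; ring. Qed.
Lemma mink_zero_r (a : R4) : mink a zero = 0.
Proof. unfold mink; to_components; ring. Qed.

Ltac mink_expand :=
  repeat first [rewrite mink_plus_l | rewrite mink_minus_l | rewrite mink_scal_l
    | rewrite mink_plus_r | rewrite mink_minus_r | rewrite mink_scal_r];
  rewrite ?mink_zero_l, ?mink_zero_r.

(** Cramer's rule: each component of r times the determinant is a combination of the
    four products. *)
Lemma orthogonal_to_frame (a b c d r : R4) : det4 a b c d <> 0 ->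
  mink r a = 0 -> mink r b = 0 -> mink r c = 0 -> mink r d = 0 -> r = zero.
Proof.
  intros Hd Ha Hb Hc He.
  assert (Z : forall x, x * det4 a b c d = 0 -> x = 0).
  { intros x Hx. apply Rmult_integral in Hx. tauto. }
  apply R4_ext; to_components; apply Z.
  - transitivity
      (mink r a * det3 (x2 b) (x3 b) (x4 b) (x2 c) (x3 c) (x4 c) (x2 d) (x3 d) (x4 d)
       - mink r b * det3 (x2 a) (x3 a) (x4 a) (x2 c) (x3 c) (x4 c) (x2 d) (x3 d) (x4 d)
       + mink r c * det3 (x2 a) (x3 a) (x4 a) (x2 b) (x3 b) (x4 b) (x2 d) (x3 d) (x4 d)
       - mink r d * det3 (x2 a) (x3 a) (x4 a) (x2 b) (x3 b) (x4 b) (x2 c) (x3 c) (x4 c)).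
    + unfold det4, det3, mink; ring.
    + rewrite Ha, Hb, Hc, He; ring.
  - transitivity
      (- (mink r a * det3 (x1 b) (x3 b) (x4 b) (x1 c) (x3 c) (x4 c) (x1 d) (x3 d) (x4 d)
       - mink r b * det3 (x1 a) (x3 a) (x4 a) (x1 c) (x3 c) (x4 c) (x1 d) (x3 d) (x4 d)
       + mink r c * det3 (x1 a) (x3 a) (x4 a) (x1 b) (x3 b) (x4 b) (x1 d) (x3 d) (x4 d)
       - mink r d * det3 (x1 a) (x3 a) (x4 a) (x1 b) (x3 b) (x4 b) (x1 c) (x3 c) (x4 c))).
    + unfold det4, det3, mink; ring.
    + rewrite Ha, Hb, Hc, He; ring.
  - transitivity
      (mink r a * det3 (x1 b) (x2 b) (x4 b) (x1 c) (x2 c) (x4 c) (x1 d) (x2 d) (x4 d)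
       - mink r b * det3 (x1 a) (x2 a) (x4 a) (x1 c) (x2 c) (x4 c) (x1 d) (x2 d) (x4 d)
       + mink r c * det3 (x1 a) (x2 a) (x4 a) (x1 b) (x2 b) (x4 b) (x1 d) (x2 d) (x4 d)
       - mink r d * det3 (x1 a) (x2 a) (x4 a) (x1 b) (x2 b) (x4 b) (x1 c) (x2 c) (x4 c)).
    + unfold det4, det3, mink; ring.
    + rewrite Ha, Hb, Hc, He; ring.
  - transitivity
      (mink r a * det3 (x1 b) (x2 b) (x3 b) (x1 c) (x2 c) (x3 c) (x1 d) (x2 d) (x3 d)
       - mink r b * det3 (x1 a) (x2 a) (x3 a) (x1 c) (x2 c) (x3 c) (x1 d) (x2 d) (x3 d)
       + mink r c * det3 (x1 a) (x2 a) (x3 a) (x1 b) (x2 b) (x3 b) (x1 d) (x2 d) (x3 d)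
       - mink r d * det3 (x1 a) (x2 a) (x3 a) (x1 b) (x2 b) (x3 b) (x1 c) (x2 c) (x3 c)).
    + unfold det4, det3, mink; ring.
    + rewrite Ha, Hb, Hc, He; ring.
Qed.

(** * Derivatives of curves and of vector fields *)

Lemma is_derive_value (f : R -> R) (s l l' : R) : is_derive f s l -> l = l' -> is_derive f s l'.
Proof. intros H <-. exact H. Qed.

Definition differentiable_curve (c : R -> R4) (s : R) : Prop :=
  ex_derive (fun r => x1 (c r)) s /\ ex_derive (fun r => x2 (c r)) s /\
  ex_derive (fun r => x3 (c r)) s /\ ex_derive (fun r => x4 (c r)) s.

Lemma is_derive_mink (a b : R -> R4) (s : R) :
  differentiable_curve a s -> differentiable_curve b s ->
  is_derive (fun r => mink (a r) (b r)) s
    (mink (velocity a s) (b s) + mink (a s) (velocity b s)).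
Proof.
  intros [A1 [A2 [A3 A4]]] [B1 [B2 [B3 B4]]].
  assert (P : forall p q : R -> R, ex_derive p s -> ex_derive q s ->
            is_derive (fun r => p r * q r) s (Derive p s * q s + p s * Derive q s)).
  { intros p q Hp Hq. apply (is_derive_mult p q); try (intros; apply Rmult_comm);
      apply Derive_correct; assumption. }
  pose proof (P _ _ A1 B1) as P1. pose proof (P _ _ A2 B2) as P2.
  pose proof (P _ _ A3 B3) as P3. pose proof (P _ _ A4 B4) as P4.
  pose proof (is_derive_minus _ _ _ _ _
    (is_derive_plus _ _ _ _ _ (is_derive_plus _ _ _ _ _ P1 P2) P3) P4) as Q.
  unfold mink. apply (is_derive_value _ _ _ _ Q).
  unfold minus, plus, opp, velocity, x1, x2, x3, x4; simpl. ring.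
Qed.

Lemma velocity_plus (a b : R -> R4) (s : R) :
  differentiable_curve a s -> differentiable_curve b s ->
  velocity (fun r => plus (a r) (b r)) s = plus (velocity a s) (velocity b s).
Proof.
  intros [A1 [A2 [A3 A4]]] [B1 [B2 [B3 B4]]].
  apply R4_ext; to_components; apply is_derive_unique;
    apply (is_derive_plus (V := R_NormedModule));
    apply Derive_correct; assumption.
Qed.

Lemma velocity_minus (a b : R -> R4) (s : R) :
  differentiable_curve a s -> differentiable_curve b s ->
  velocity (fun r => minus (a r) (b r)) s = minus (velocity a s) (velocity b s).
Proof.
  intros [A1 [A2 [A3 A4]]] [B1 [B2 [B3 B4]]].
  apply R4_ext; to_components; apply is_derive_unique;
    apply (is_derive_minus (V := R_NormedModule));
    apply Derive_correct; assumption.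
Qed.

Lemma velocity_scal (k : R -> R) (a : R -> R4) (s : R) :
  ex_derive k s -> differentiable_curve a s ->
  velocity (fun r => scal (k r) (a r)) s =
  plus (scal (Derive k s) (a s)) (scal (k s) (velocity a s)).
Proof.
  intros K [A1 [A2 [A3 A4]]].
  apply R4_ext; to_components; apply is_derive_unique;
    apply (is_derive_mult k); try (intros; apply Rmult_comm);
    apply Derive_correct; assumption.
Qed.

Lemma velocity_const (a : R4) (s : R) : velocity (fun _ => a) s = zero.
Proof. apply R4_ext; exact (Derive_const _ s). Qed.

Lemma differentiable_curve_const (a : R4) (s : R) : differentiable_curve (fun _ => a) s.
Proof. repeat split; apply ex_derive_const. Qed.

Lemma d_u_const (a : R4) (u v : R) : d_u (fun _ _ => a) u v = zero.
Proof. apply velocity_const. Qed.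

Lemma d_v_const (a : R4) (u v : R) : d_v (fun _ _ => a) u v = zero.
Proof. apply velocity_const. Qed.

Section Fields.
Variable V : R * R -> Prop.
Hypothesis V_open : open V.

Lemma smooth_field_curve_u a u v : smooth_field V a -> V (u, v) ->
  differentiable_curve (fun r => a r v) u.
Proof.
  intros [A1 [A2 [A3 A4]]] Hp.
  repeat split; [exact (smooth2_ex_derive_u V _ u v A1 Hp) | exact (smooth2_ex_derive_u V _ u v A2 Hp)
    | exact (smooth2_ex_derive_u V _ u v A3 Hp) | exact (smooth2_ex_derive_u V _ u v A4 Hp)].
Qed.

Lemma smooth_field_curve_v a u v : smooth_field V a -> V (u, v) ->
  differentiable_curve (fun r => a u r) v.
Proof.
  intros [A1 [A2 [A3 A4]]] Hp.
  repeat split; [exact (smooth2_ex_derive_v V _ u v A1 Hp) | exact (smooth2_ex_derive_v V _ u v A2 Hp)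
    | exact (smooth2_ex_derive_v V _ u v A3 Hp) | exact (smooth2_ex_derive_v V _ u v A4 Hp)].
Qed.

Lemma smooth_field_d_u a : smooth_field V a -> smooth_field V (d_u a).
Proof. intros [A1 [A2 [A3 A4]]]. repeat split; apply smooth2_partial_u; assumption. Qed.

Lemma smooth_field_d_v a : smooth_field V a -> smooth_field V (d_v a).
Proof. intros [A1 [A2 [A3 A4]]]. repeat split; apply smooth2_partial_v; assumption. Qed.

Lemma smooth_field_const a : smooth_field V (fun _ _ => a).
Proof. repeat split; apply smooth2_const; assumption. Qed.

Lemma smooth_field_plus a b : smooth_field V a -> smooth_field V b ->
  smooth_field V (fun u v => plus (a u v) (b u v)).
Proof.
  intros [A1 [A2 [A3 A4]]] [B1 [B2 [B3 B4]]].
  repeat split; apply smooth2_plus; assumption.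
Qed.

Lemma smooth_field_minus a b : smooth_field V a -> smooth_field V b ->
  smooth_field V (fun u v => minus (a u v) (b u v)).
Proof.
  intros [A1 [A2 [A3 A4]]] [B1 [B2 [B3 B4]]].
  repeat split; apply smooth2_minus; assumption.
Qed.

Lemma smooth_field_scal k a : smooth2 V k -> smooth_field V a ->
  smooth_field V (fun u v => scal (k u v) (a u v)).
Proof.
  intros K [A1 [A2 [A3 A4]]].
  repeat split; apply smooth2_mult; assumption.
Qed.

Lemma smooth2_mink a b : smooth_field V a -> smooth_field V b ->
  smooth2 V (fun u v => mink (a u v) (b u v)).
Proof.
  intros [A1 [A2 [A3 A4]]] [B1 [B2 [B3 B4]]].
  unfold mink. apply smooth2_minus; auto. repeat apply smooth2_plus; auto;
  apply smooth2_mult; assumption. apply smooth2_mult; assumption.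
Qed.

Lemma partial_u_mink a b u v : smooth_field V a -> smooth_field V b -> V (u, v) ->
  partial_u (fun u v => mink (a u v) (b u v)) u v = mink (d_u a u v) (b u v) + mink (a u v) (d_u b u v).
Proof.
  intros. apply is_derive_unique. apply (is_derive_mink (fun r => a r v) (fun r => b r v));
    [apply (smooth_field_curve_u a u v) | apply (smooth_field_curve_u b u v)]; assumption.
Qed.

Lemma partial_v_mink a b u v : smooth_field V a -> smooth_field V b -> V (u, v) ->
  partial_v (fun u v => mink (a u v) (b u v)) u v = mink (d_v a u v) (b u v) + mink (a u v) (d_v b u v).
Proof.
  intros. apply is_derive_unique. apply (is_derive_mink (fun r => a u r) (fun r => b u r));
    [apply (smooth_field_curve_v a u v) | apply (smooth_field_curve_v b u v)]; assumption.
Qed.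

Lemma partial_u_ext f g u v : V (u, v) -> (forall u v, V (u, v) -> f u v = g u v) -> partial_u f u v = partial_u g u v.
Proof.
  intros Hp E. apply Derive_ext_loc.
  apply (open_locally_u V (fun r => f r v = g r v) u v); auto.
Qed.

Lemma partial_v_ext f g u v : V (u, v) -> (forall u v, V (u, v) -> f u v = g u v) -> partial_v f u v = partial_v g u v.
Proof.
  intros Hp E. apply Derive_ext_loc.
  apply (open_locally_v V (fun r => f u r = g u r) u v); auto.
Qed.

(** Differentiating a constant product moves the derivative to the other factor.
    Applied to orthogonality relations this yields the Weingarten and Codazzi equations. *)
Lemma mink_constant_d a b k u v : smooth_field V a -> smooth_field V b -> V (u, v) ->
  (forall u v, V (u, v) -> mink (a u v) (b u v) = k) ->
  mink (d_u a u v) (b u v) = - mink (a u v) (d_u b u v) /\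
  mink (d_v a u v) (b u v) = - mink (a u v) (d_v b u v).
Proof.
  intros Ha Hb Hp Hk.
  pose proof (partial_u_mink a b u v Ha Hb Hp) as Eu. pose proof (partial_v_mink a b u v Ha Hb Hp) as Ev.
  rewrite (partial_u_ext _ (fun _ _ => k) u v Hp Hk) in Eu.
  rewrite (partial_v_ext _ (fun _ _ => k) u v Hp Hk) in Ev.
  unfold partial_u in Eu; unfold partial_v in Ev. rewrite Derive_const in Eu, Ev. lra.
Qed.

Lemma d_v_d_u a u v : smooth_field V a -> V (u, v) -> d_v (d_u a) u v = d_u (d_v a) u v.
Proof.
  intros [A1 [A2 [A3 A4]]] Hp.
  apply R4_ext; [exact (smooth2_schwarz V V_open _ u v A1 Hp) | exact (smooth2_schwarz V V_open _ u v A2 Hp)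
    | exact (smooth2_schwarz V V_open _ u v A3 Hp) | exact (smooth2_schwarz V V_open _ u v A4 Hp)].
Qed.

End Fields.

(** * Normal fields and the ruling through a flat point of rank one *)

Lemma span2_sub (p q a b w : R4) :
  in_span2 p q a -> in_span2 p q b -> in_span2 a b w -> in_span2 p q w.
Proof.
  intros [s1 [t1 ->]] [s2 [t2 ->]] [x [y ->]].
  exists (x * s1 + y * s2), (x * t1 + y * t2). apply R4_ext; to_components; ring.
Qed.

Lemma span2_eq (p q a b : R4) :
  in_span2 p q a -> in_span2 p q b -> lin_indep2 a b ->
  forall w, in_span2 a b w <-> in_span2 p q w.
Proof.
  intros Ha Hb Hi w. split; [apply span2_sub; assumption|].
  destruct Ha as [s1 [t1 Ea]], Hb as [s2 [t2 Eb]].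
  destruct (Req_dec (s1 * t2 - t1 * s2) 0) as [Z | NZ].
  - exfalso.
    destruct (Hi t2 (- t1)) as [T2 T1].
    { rewrite Ea, Eb. apply R4_ext; to_components.
      all: match goal with |- _ * (_ * ?x + _ * ?y) + _ = _ =>
             transitivity ((s1 * t2 - t1 * s2) * x); [ring | rewrite Z; ring] end. }
    destruct (Hi s2 (- s1)) as [S2 S1].
    { rewrite Ea, Eb. apply R4_ext; to_components.
      all: match goal with |- _ * (_ * ?x + _ * ?y) + _ = _ =>
             transitivity (- (s1 * t2 - t1 * s2) * y); [ring | rewrite Z; ring] end. }
    destruct (Hi 1 0) as [O _]; [|lra].
    assert (Zs : s1 = 0) by lra. assert (Zt : t1 = 0) by lra.
    rewrite Ea, Zs, Zt. apply R4_ext; to_components; ring.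
  - intros Hw. apply (span2_sub a b p q); [| |exact Hw].
    + exists (t2 / (s1 * t2 - t1 * s2)), (- t1 / (s1 * t2 - t1 * s2)).
      rewrite Ea, Eb. apply R4_ext; to_components; field; exact NZ.
    + exists (- s2 / (s1 * t2 - t1 * s2)), (s1 / (s1 * t2 - t1 * s2)).
      rewrite Ea, Eb. apply R4_ext; to_components; field; exact NZ.
Qed.

Definition normal_to (V : R * R -> Prop) (z n : R -> R -> R4) : Prop :=
  smooth_field V n /\ forall u v, V (u, v) ->
    mink (d_u z u v) (n u v) = 0 /\ mink (d_v z u v) (n u v) = 0.

(** Stated through orthogonality, so that tangency of a vector can be checked against the
    two normal fields only. *)
Definition normals_span (V : R * R -> Prop) (z n n' : R -> R -> R4) : Prop :=
  forall u v, V (u, v) -> forall w, mink w (n u v) = 0 -> mink w (n' u v) = 0 ->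
    in_span2 (d_u z u v) (d_v z u v) w.

Section NormalFields.
Variables (V : R * R -> Prop) (z n : R -> R -> R4).
Hypotheses (V_open : open V) (z_smooth : smooth_field V z) (n_normal : normal_to V z n).

Lemma weingarten u v : V (u, v) ->
  mink (d_u z u v) (d_u n u v) = - c11 z n u v /\
  mink (d_u z u v) (d_v n u v) = - c12 z n u v /\
  mink (d_v z u v) (d_u n u v) = - c12 z n u v /\
  mink (d_v z u v) (d_v n u v) = - c22 z n u v.
Proof.
  intros Hp. destruct n_normal as [Hn H0].
  destruct (mink_constant_d V V_open (d_u z) n 0 u v) as [A1 A2];
    auto using smooth_field_d_u. { intros x y H; apply H0, H. }
  destruct (mink_constant_d V V_open (d_v z) n 0 u v) as [B1 B2];
    auto using smooth_field_d_v. { intros x y H; apply H0, H. }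
  rewrite <- (d_v_d_u V V_open z u v z_smooth Hp) in B1.
  unfold c11, c12, c22. lra.
Qed.

Lemma smooth2_c11 : smooth2 V (c11 z n).
Proof. apply smooth2_mink; [exact V_open | | apply n_normal]. now apply smooth_field_d_u, smooth_field_d_u. Qed.
Lemma smooth2_c12 : smooth2 V (c12 z n).
Proof. apply smooth2_mink; [exact V_open | | apply n_normal]. now apply smooth_field_d_v, smooth_field_d_u. Qed.
Lemma smooth2_c22 : smooth2 V (c22 z n).
Proof. apply smooth2_mink; [exact V_open | | apply n_normal]. now apply smooth_field_d_v, smooth_field_d_v. Qed.
End NormalFields.

(** Tangent vectors w with sigma(w, .) = 0.  When the second fundamental form has rank one
    this is the asymptotic direction, that of the ruling. *)
Definition nullity_direction (z n n' : R -> R -> R4) (u v : R) (w : R4) : Prop :=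
  w <> zero /\ exists x y : R, w = plus (scal x (d_u z u v)) (scal y (d_v z u v)) /\
    x * c11 z n u v + y * c12 z n u v = 0 /\ x * c12 z n u v + y * c22 z n u v = 0 /\
    x * c11 z n' u v + y * c12 z n' u v = 0 /\ x * c12 z n' u v + y * c22 z n' u v = 0.

(** The local form of the conclusion, with the direction of the ruling tied to the second
    fundamental form, hence independent of the chosen neighborhood. *)
Definition locally_ruled (V : R * R -> Prop) (z n n' : R -> R -> R4) (p : R * R) : Prop :=
  exists (Q : R * R -> Prop) (a b : R) (c e : R -> R4) (s t : R -> R -> R),
    open Q /\ Q p /\ (forall q, Q q -> V q) /\
    developable_ruled a b c e /\ smooth2 Q s /\ smooth2 Q t /\
    forall u v : R, Q (u, v) ->
      a < s u v < b /\ z u v = ruled c e (s u v) (t u v) /\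
      nullity_direction z n n' u v (e (s u v)).

Lemma smooth2_sub (V Q : R * R -> Prop) f :
  (forall q, Q q -> V q) -> smooth2 V f -> smooth2 Q f.
Proof. intros H Hf u v Hq; apply Hf, H, Hq. Qed.

Lemma smooth_field_sub (V Q : R * R -> Prop) a :
  (forall q, Q q -> V q) -> smooth_field V a -> smooth_field Q a.
Proof.
  intros H [A1 [A2 [A3 A4]]]. repeat split; apply (smooth2_sub V); assumption.
Qed.

(** The field xi = d/du + ruling_slope d/dv spans the kernel of the second fundamental form
    where c22 is nonzero, and ruling_vector is the image of xi under the differential of z. *)
Definition ruling_slope (z n : R -> R -> R4) (u v : R) : R := - c12 z n u v / c22 z n u v.
Definition ruling_vector (z n : R -> R -> R4) (u v : R) : R4 :=
  plus (d_u z u v) (scal (ruling_slope z n u v) (d_v z u v)).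

Section Ruling.
Variables (V : R * R -> Prop) (z n n' : R -> R -> R4).
Hypotheses (V_open : open V) (z_smooth : smooth_field V z)
  (n_normal : normal_to V z n) (n'_normal : normal_to V z n')
  (span : normals_span V z n n')
  (c22_neq : forall u v, V (u, v) -> c22 z n u v <> 0)
  (rank1 : forall u v, V (u, v) ->
    c11 z n u v * c22 z n u v = c12 z n u v * c12 z n u v /\
    c11 z n' u v * c22 z n u v = c12 z n' u v * c12 z n u v /\
    c12 z n' u v * c22 z n u v = c22 z n' u v * c12 z n u v).

Lemma smooth_ruling_vector : smooth_field V (ruling_vector z n).
Proof.
  apply smooth_field_plus; [exact V_open | now apply smooth_field_d_u |].
  apply smooth_field_scal; [exact V_open | | now apply smooth_field_d_v].
  apply smooth2_div; auto.
  - apply smooth2_opp; [exact V_open | now apply smooth2_c12].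
  - now apply smooth2_c22.
Qed.

Lemma second_form_kernel u v : V (u, v) ->
  (c11 z n u v + ruling_slope z n u v * c12 z n u v = 0 /\ c12 z n u v + ruling_slope z n u v * c22 z n u v = 0) /\
  (c11 z n' u v + ruling_slope z n u v * c12 z n' u v = 0 /\ c12 z n' u v + ruling_slope z n u v * c22 z n' u v = 0).
Proof.
  intros Hp. destruct (rank1 u v Hp) as [R1 [R2 R3]]. pose proof (c22_neq u v Hp) as H0.
  assert (Z : forall x, c22 z n u v * x = 0 -> x = 0).
  { intros x Hx. apply Rmult_integral in Hx. tauto. }
  repeat split; apply Z; unfold ruling_slope; field_simplify; auto; lra.
Qed.

(** Its products with the derivatives of a normal field are the values of the second
    fundamental form on the kernel. *)
Lemma ruling_vector_normal u v : V (u, v) ->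
  (mink (ruling_vector z n u v) (n u v) = 0 /\ mink (ruling_vector z n u v) (d_u n u v) = 0 /\
   mink (ruling_vector z n u v) (d_v n u v) = 0) /\
  (mink (ruling_vector z n u v) (n' u v) = 0 /\ mink (ruling_vector z n u v) (d_u n' u v) = 0 /\
   mink (ruling_vector z n u v) (d_v n' u v) = 0).
Proof.
  intros Hp. destruct (second_form_kernel u v Hp) as [[K1 K2] [K3 K4]].
  destruct (weingarten V z n V_open z_smooth n_normal u v Hp) as [W1 [W2 [W3 W4]]].
  destruct (weingarten V z n' V_open z_smooth n'_normal u v Hp) as [X1 [X2 [X3 X4]]].
  destruct (proj2 n_normal u v Hp) as [N1 N2]. destruct (proj2 n'_normal u v Hp) as [N3 N4].
  unfold ruling_vector. mink_expand.
  rewrite W1, W2, W3, W4, X1, X2, X3, X4, N1, N2, N3, N4.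
  repeat split; lra.
Qed.

Section Direction.
Variables (l0 z0 om : R4).
Hypothesis (l0_neq : forall u v, V (u, v) -> mink (ruling_vector z n u v) l0 <> 0).

(** Normalizing makes the field constant along the ruling and not just parallel to it; a
    fixed linear function does this without square roots. *)
Definition ruling_field (u v : R) : R4 := scal (/ mink (ruling_vector z n u v) l0) (ruling_vector z n u v).
Definition height (u v : R) : R := mink (minus (z u v) z0) l0.
(** The intersection of the ruling with the hyperplane through z0 orthogonal to l0. *)
Definition foot_point (u v : R) : R4 := minus (z u v) (scal (height u v) (ruling_field u v)).
(** A function that distinguishes the rulings near a point, for a suitable vector om. *)
Definition leaf_coordinate (u v : R) : R := mink (foot_point u v) om.

Lemma smooth_ruling_field : smooth_field V ruling_field.
Proof.
  apply smooth_field_scal; [exact V_open | | exact smooth_ruling_vector].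
  apply smooth2_inv; auto. apply smooth2_mink; auto using smooth_ruling_vector, smooth_field_const.
Qed.

Lemma smooth_height : smooth2 V height.
Proof.
  apply smooth2_mink; auto using smooth_field_const.
  apply smooth_field_minus; auto using smooth_field_const.
Qed.

Lemma smooth_foot_point : smooth_field V foot_point.
Proof.
  apply smooth_field_minus; auto. apply smooth_field_scal; auto using smooth_height, smooth_ruling_field.
Qed.

Lemma smooth_leaf_coordinate : smooth2 V leaf_coordinate.
Proof. apply smooth2_mink; auto using smooth_foot_point, smooth_field_const. Qed.

Lemma ruling_field_normalized u v : V (u, v) -> mink (ruling_field u v) l0 = 1.
Proof. intros Hp. unfold ruling_field. mink_expand. now apply Rinv_l, l0_neq. Qed.

(** The field is in the kernel of the second fundamental form, so it is orthogonal to
    the normal fields and to their derivatives; the product rule does the rest. *)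
Lemma d_ruling_field_tangent nu u v : (nu = n \/ nu = n') -> V (u, v) ->
  mink (d_u ruling_field u v) (nu u v) = 0 /\ mink (d_v ruling_field u v) (nu u v) = 0.
Proof.
  intros Hnu Hp.
  assert (Hn : normal_to V z nu) by (destruct Hnu as [-> | ->]; assumption).
  assert (H0 : forall u v, V (u, v) -> mink (ruling_field u v) (nu u v) = 0 /\
             mink (ruling_field u v) (d_u nu u v) = 0 /\ mink (ruling_field u v) (d_v nu u v) = 0).
  { intros x y H. unfold ruling_field. mink_expand. pose proof (ruling_vector_normal x y H) as L.
    destruct Hnu as [-> | ->]; destruct L as [[L1 [L2 L3]] [L4 [L5 L6]]];
      rewrite ?L1, ?L2, ?L3, ?L4, ?L5, ?L6; repeat split; ring. }
  destruct (mink_constant_d V V_open ruling_field nu 0 u v smooth_ruling_field (proj1 Hn) Hp) as [E1 E2].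
  { intros x y H; apply H0, H. }
  destruct (H0 u v Hp) as [_ [E3 E4]]. lra.
Qed.

(** The derivative along xi is tangent.  By the Codazzi equation and c22 <> 0 it is a
    multiple of the ruling vector, and the normalization <ruling_field, l0> = 1 forces that
    multiple to vanish. *)
Lemma ruling_field_constant u v : V (u, v) ->
  plus (d_u ruling_field u v) (scal (ruling_slope z n u v) (d_v ruling_field u v)) = zero.
Proof.
  intros Hp.
  destruct (d_ruling_field_tangent n u v (or_introl eq_refl) Hp) as [T1 T2].
  destruct (d_ruling_field_tangent n' u v (or_intror eq_refl) Hp) as [T3 T4].
  destruct (span u v Hp _ T1 T3) as [a1 [b1 E1]].
  destruct (span u v Hp _ T2 T4) as [a2 [b2 E2]].
  assert (Cod : mink (d_u ruling_field u v) (d_v n u v) = mink (d_v ruling_field u v) (d_u n u v)).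
  { pose proof (mink_constant_d V V_open (d_u ruling_field) n 0 u v (smooth_field_d_u V _ smooth_ruling_field)
      (proj1 n_normal) Hp (fun x y H => proj1 (d_ruling_field_tangent n x y (or_introl eq_refl) H))) as [_ X1].
    pose proof (mink_constant_d V V_open (d_v ruling_field) n 0 u v (smooth_field_d_v V _ smooth_ruling_field)
      (proj1 n_normal) Hp (fun x y H => proj2 (d_ruling_field_tangent n x y (or_introl eq_refl) H))) as [X2 _].
    rewrite (d_v_d_u V V_open ruling_field u v smooth_ruling_field Hp) in X1. lra. }
  assert (L : mink (d_u ruling_field u v) l0 = 0 /\ mink (d_v ruling_field u v) l0 = 0).
  { pose proof (mink_constant_d V V_open ruling_field (fun _ _ => l0) 1 u v smooth_ruling_field
      (smooth_field_const V V_open l0) Hp ruling_field_normalized) as [X1 X2].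
    rewrite d_u_const, mink_zero_r in X1. rewrite d_v_const, mink_zero_r in X2. lra. }
  destruct (weingarten V z n V_open z_smooth n_normal u v Hp) as [W1 [W2 [W3 W4]]].
  destruct (second_form_kernel u v Hp) as [[K1 K2] _].
  set (k := ruling_slope z n u v) in *.
  assert (B : b1 + k * b2 = k * (a1 + k * a2)).
  { rewrite E1, E2 in Cod. revert Cod. mink_expand. rewrite W1, W2, W3, W4.
    assert (F1 : c12 z n u v = - k * c22 z n u v) by lra.
    assert (F2 : c11 z n u v = k * k * c22 z n u v).
    { replace (c11 z n u v) with (- k * c12 z n u v) by lra. rewrite F1; ring. }
    rewrite F2, F1. intros Cod.
    apply Rmult_eq_reg_r with (c22 z n u v); [lra | now apply c22_neq]. }
  assert (X : plus (d_u ruling_field u v) (scal k (d_v ruling_field u v)) = scal (a1 + k * a2) (ruling_vector z n u v)).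
  { rewrite E1, E2. unfold ruling_vector. fold k. apply R4_ext; to_components;
    match goal with |- _ + _ * ?y + _ * (_ * ?x + _ * ?y) = _ =>
       transitivity ((a1 + k * a2) * x + (b1 + k * b2) * y); [ring | rewrite B; ring] end. }
  assert (Y : (a1 + k * a2) * mink (ruling_vector z n u v) l0 = 0).
  { rewrite <- mink_scal_l, <- X. mink_expand. destruct L as [-> ->]; ring. }
  apply Rmult_integral in Y. destruct Y as [Y | Y]; [|now apply l0_neq in Y].
  rewrite X, Y. apply R4_ext; to_components; ring.
Qed.

Lemma d_foot_point u v : V (u, v) ->
  d_u foot_point u v = minus (d_u z u v)
    (plus (scal (mink (d_u z u v) l0) (ruling_field u v)) (scal (height u v) (d_u ruling_field u v))) /\
  d_v foot_point u v = minus (d_v z u v)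
    (plus (scal (mink (d_v z u v) l0) (ruling_field u v)) (scal (height u v) (d_v ruling_field u v))).
Proof.
  intros Hp.
  assert (Sz : smooth_field V (fun x y => minus (z x y) z0))
    by (apply smooth_field_minus; auto using smooth_field_const).
  assert (Ss : smooth_field V (fun x y => scal (height x y) (ruling_field x y)))
    by (apply smooth_field_scal; auto using smooth_height, smooth_ruling_field).
  split.
  - unfold d_u, foot_point. rewrite (velocity_minus (fun r => z r v) (fun r => scal (height r v) (ruling_field r v)));
      [| apply (smooth_field_curve_u V z); auto
       | apply (smooth_field_curve_u V (fun x y => scal (height x y) (ruling_field x y))); auto].
    f_equal. rewrite (velocity_scal (fun r => height r v) (fun r => ruling_field r v));
      [| apply (smooth2_ex_derive_u V height); auto using smooth_height
       | apply (smooth_field_curve_u V ruling_field); auto using smooth_ruling_field].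
    f_equal. f_equal. 
    transitivity (mink (d_u (fun x y => minus (z x y) z0) u v) l0 +
                  mink (minus (z u v) z0) (d_u (fun _ _ => l0) u v)).
    + apply (partial_u_mink V (fun x y => minus (z x y) z0) (fun _ _ => l0)); auto using smooth_field_const.
    + rewrite d_u_const. unfold d_u. rewrite (velocity_minus (fun r => z r v) (fun _ => z0)), velocity_const;
        [mink_expand; ring | apply (smooth_field_curve_u V z); auto | apply differentiable_curve_const].
  - unfold d_v, foot_point. rewrite (velocity_minus (fun r => z u r) (fun r => scal (height u r) (ruling_field u r)));
      [| apply (smooth_field_curve_v V z); auto
       | apply (smooth_field_curve_v V (fun x y => scal (height x y) (ruling_field x y))); auto].
    f_equal. rewrite (velocity_scal (fun r => height u r) (fun r => ruling_field u r));
      [| apply (smooth2_ex_derive_v V height); auto using smooth_height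
       | apply (smooth_field_curve_v V ruling_field); auto using smooth_ruling_field].
    f_equal. f_equal.
    transitivity (mink (d_v (fun x y => minus (z x y) z0) u v) l0 +
                  mink (minus (z u v) z0) (d_v (fun _ _ => l0) u v)).
    + apply (partial_v_mink V (fun x y => minus (z x y) z0) (fun _ _ => l0)); auto using smooth_field_const.
    + rewrite d_v_const. unfold d_v. rewrite (velocity_minus (fun r => z u r) (fun _ => z0)), velocity_const;
        [mink_expand; ring | apply (smooth_field_curve_v V z); auto | apply differentiable_curve_const].
Qed.

(** The derivative of z along xi is the ruling vector, and that of the height is its product
    with l0, so the two terms cancel by the choice of the ruling field. *)
Lemma foot_point_constant u v : V (u, v) ->
  plus (d_u foot_point u v) (scal (ruling_slope z n u v) (d_v foot_point u v)) = zero.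
Proof.
  intros Hp. destruct (d_foot_point u v Hp) as [-> ->].
  pose proof (ruling_field_constant u v Hp) as E.
  transitivity (minus (minus (ruling_vector z n u v) (scal (mink (ruling_vector z n u v) l0) (ruling_field u v)))
    (scal (height u v) (plus (d_u ruling_field u v) (scal (ruling_slope z n u v) (d_v ruling_field u v))))).
  - unfold ruling_vector at 1 2. rewrite mink_plus_l, mink_scal_l. apply R4_ext; to_components; ring.
  - rewrite E. unfold ruling_field. pose proof (l0_neq u v Hp).
    apply R4_ext; to_components; field; assumption.
Qed.

Lemma d_foot_point_tangent nu u v : (nu = n \/ nu = n') -> V (u, v) ->
  mink (d_v foot_point u v) (nu u v) = 0.
Proof.
  intros Hnu Hp. destruct (d_foot_point u v Hp) as [_ ->]. mink_expand.
  rewrite (proj2 (d_ruling_field_tangent nu u v Hnu Hp)).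
  assert (E : mink (ruling_field u v) (nu u v) = 0 /\ mink (d_v z u v) (nu u v) = 0).
  { pose proof (ruling_vector_normal u v Hp) as [[L1 _] [L2 _]].
    unfold ruling_field. mink_expand. destruct Hnu as [-> | ->]; [rewrite L1 | rewrite L2]; split;
      try ring; [apply (proj2 n_normal u v Hp) | apply (proj2 n'_normal u v Hp)]. }
  destruct E as [-> ->]; ring.
Qed.

Lemma d_leaf_coordinate u v : V (u, v) ->
  partial_u leaf_coordinate u v = mink (d_u foot_point u v) om /\ partial_v leaf_coordinate u v = mink (d_v foot_point u v) om.
Proof.
  intros Hp. unfold leaf_coordinate.
  rewrite (partial_u_mink V foot_point (fun _ _ => om)), (partial_v_mink V foot_point (fun _ _ => om));
    auto using smooth_foot_point, smooth_field_const.
  rewrite d_u_const, d_v_const, !mink_zero_r. split; ring.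
Qed.

(** Both gradients are annihilated by xi, hence parallel. *)
Lemma jacobian_with_leaf_coordinate (a : R -> R -> R4) :
  (forall u v, V (u, v) -> plus (d_u a u v) (scal (ruling_slope z n u v) (d_v a u v)) = zero) ->
  forall u v, V (u, v) -> forall i : R4 -> R, i = x1 \/ i = x2 \/ i = x3 \/ i = x4 ->
    partial_u (fun x y => i (a x y)) u v * partial_v leaf_coordinate u v = partial_v (fun x y => i (a x y)) u v * partial_u leaf_coordinate u v.
Proof.
  intros Ha u v Hp i Hi. destruct (d_leaf_coordinate u v Hp) as [-> ->].
  pose proof (foot_point_constant u v Hp) as E. specialize (Ha u v Hp).
  apply (f_equal (fun w => mink w om)) in E. revert E. mink_expand. intros E.
  assert (F : partial_u (fun x y => i (a x y)) u v = - ruling_slope z n u v * partial_v (fun x y => i (a x y)) u v).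
  { assert (G : i (plus (d_u a u v) (scal (ruling_slope z n u v) (d_v a u v))) = i zero) by now rewrite Ha.
    assert (T : forall p q k, p + k * q = 0 -> p = - k * q) by (intros; lra).
    apply T. destruct Hi as [-> | [-> | [-> | ->]]]; exact G. }
  rewrite F. replace (mink (d_u foot_point u v) om) with (- ruling_slope z n u v * mink (d_v foot_point u v) om) by lra. ring.
Qed.

Lemma ruling_field_nullity u v : V (u, v) -> nullity_direction z n n' u v (ruling_field u v).
Proof.
  intros Hp. destruct (second_form_kernel u v Hp) as [[K1 K2] [K3 K4]]. split.
  - intros E. pose proof (ruling_field_normalized u v Hp) as E1. rewrite E, mink_zero_l in E1. lra.
  - set (q := / mink (ruling_vector z n u v) l0). exists q, (q * ruling_slope z n u v). split.
    + unfold ruling_field, ruling_vector. fold q. unfold ruling_vector in q. fold q. apply R4_ext; to_components; ring.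
    + assert (T : forall c d, c + ruling_slope z n u v * d = 0 -> q * c + q * ruling_slope z n u v * d = 0).
      { intros c d H. transitivity (q * (c + ruling_slope z n u v * d)); [ring | rewrite H; ring]. }
      auto.
Qed.

(** The rulings are parametrized by the value of the leaf coordinate, with base curve and
    direction read off along the line u = u0. *)
Lemma locally_ruled_of_increasing (u0 v0 : R) : V (u0, v0) ->
  (forall u v, V (u, v) -> 0 < partial_v leaf_coordinate u v) -> locally_ruled V z n n' (u0, v0).
Proof.
  intros V0 Hinc.
  destruct (level_coordinate V leaf_coordinate u0 v0 V_open smooth_leaf_coordinate V0 Hinc)
    as [a [b [gam [Q [Hg [HQ [Q0 [HQ' HL]]]]]]]].
  set (c := fun w => foot_point u0 (gam w)). set (e := fun w => ruling_field u0 (gam w)).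
  destruct smooth_foot_point as [C1 [C2 [C3 C4]]]. destruct smooth_ruling_field as [E1 [E2 [E3 E4]]].
  assert (Sc : smooth_curve a b c).
  { repeat split; [exact (proj1 (HL _ C1)) | exact (proj1 (HL _ C2)) | exact (proj1 (HL _ C3))
      | exact (proj1 (HL _ C4))]. }
  assert (Se : smooth_curve a b e).
  { repeat split; [exact (proj1 (HL _ E1)) | exact (proj1 (HL _ E2)) | exact (proj1 (HL _ E3))
      | exact (proj1 (HL _ E4))]. }
  assert (curve : forall k, smooth_curve a b k -> forall w, a < w < b -> differentiable_curve k w).
  { intros k [S1 [S2 [S3 S4]]] w Hw.
    repeat split; [exact (S1 w Hw 1%nat) | exact (S2 w Hw 1%nat) | exact (S3 w Hw 1%nat)
      | exact (S4 w Hw 1%nat)]. }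
  assert (Vc : forall w, a < w < b ->
            velocity c w = scal (/ partial_v leaf_coordinate u0 (gam w)) (d_v foot_point u0 (gam w))).
  { intros w Hw. apply R4_ext; to_components; rewrite Rmult_comm;
      [apply (HL _ C1) | apply (HL _ C2) | apply (HL _ C3) | apply (HL _ C4)]; exact Hw. }
  assert (Ve : forall w, a < w < b ->
            velocity e w = scal (/ partial_v leaf_coordinate u0 (gam w)) (d_v ruling_field u0 (gam w))).
  { intros w Hw. apply R4_ext; to_components; rewrite Rmult_comm;
      [apply (HL _ E1) | apply (HL _ E2) | apply (HL _ E3) | apply (HL _ E4)]; exact Hw. }
  assert (Xt : forall s t, d_v (ruled c e) s t = e s).
  { intros s t. assert (D : forall p q : R, Derive (fun r => p + r * q) t = q).
    { intros p q. apply is_derive_unique. auto_derive; [exact I | ring]. }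
    apply R4_ext; apply D. }
  assert (Xs : forall s t, a < s < b -> d_u (ruled c e) s t =
            plus (velocity c s) (scal t (velocity e s))).
  { intros s t Hs. unfold d_u, ruled.
    assert (Dt : differentiable_curve (fun r => scal t (e r)) s).
    { destruct (curve e Se s Hs) as [D1 [D2 [D3 D4]]].
      repeat split; apply (ex_derive_mult (fun _ => t)); auto using ex_derive_const. }
    rewrite (velocity_plus c (fun r => scal t (e r))); auto. f_equal.
    rewrite (velocity_scal (fun _ => t) e); auto using ex_derive_const.
    rewrite Derive_const. apply R4_ext; to_components; ring. }
  exists Q, a, b, c, e, leaf_coordinate, height.
  split; [exact HQ|]. split; [exact Q0|].
  split; [intros [u v] Hq; exact (proj1 (HQ' u v Hq))|].
  split; [|split; [|split]].
  - split; [exact Sc|]. split; [exact Se|]. split.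
    + intros s Hs Hz. pose proof (ruling_field_normalized u0 (gam s) (Hg s Hs)) as N.
      unfold e in Hz. rewrite Hz, mink_zero_l in N. lra.
    + assert (T : forall s t, a < s < b -> regular_point (ruled c e) s t -> forall w,
                in_span2 (d_u (ruled c e) s t) (d_v (ruled c e) s t) w <->
                in_span2 (d_u z u0 (gam s)) (d_v z u0 (gam s)) w).
      { intros s t Hs Hr. pose proof (Hg s Hs) as Hp.
        assert (M : forall nu, nu = n \/ nu = n' ->
                  mink (d_u (ruled c e) s t) (nu u0 (gam s)) = 0 /\
                  mink (d_v (ruled c e) s t) (nu u0 (gam s)) = 0).
        { intros nu Hnu. rewrite Xt, (Xs s t Hs), (Vc s Hs), (Ve s Hs). mink_expand.
          rewrite (d_foot_point_tangent nu _ _ Hnu Hp), (proj2 (d_ruling_field_tangent nu _ _ Hnu Hp)).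
          split; [ring|]. unfold e, ruling_field. mink_expand.
          pose proof (ruling_vector_normal u0 (gam s) Hp) as [[L1 _] [L2 _]].
          destruct Hnu as [-> | ->]; [rewrite L1 | rewrite L2]; ring. }
        apply span2_eq; [| | exact Hr]; apply span; auto; apply M; auto. }
      intros s t t' Hs Ht Ht' w. rewrite (T s t Hs Ht w), (T s t' Hs Ht' w). reflexivity.
  - apply (smooth2_sub V); [|exact smooth_leaf_coordinate].
    intros [u v] Hq; exact (proj1 (HQ' u v Hq)).
  - apply (smooth2_sub V); [|exact smooth_height].
    intros [u v] Hq; exact (proj1 (HQ' u v Hq)).
  - intros u v Hq. destruct (HQ' u v Hq) as [Hp Hab]. split; [exact Hab|].
    assert (Ec : c (leaf_coordinate u v) = foot_point u v).
    { symmetry. unfold c. pose proof (jacobian_with_leaf_coordinate foot_point foot_point_constant) as J.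
      apply R4_ext; [apply (HL _ C1) | apply (HL _ C2) | apply (HL _ C3) | apply (HL _ C4)];
        try exact Hq; intros x y Hxy; apply (J x y Hxy); auto. }
    assert (Ee : e (leaf_coordinate u v) = ruling_field u v).
    { symmetry. unfold e. pose proof (jacobian_with_leaf_coordinate ruling_field ruling_field_constant) as J.
      apply R4_ext; [apply (HL _ E1) | apply (HL _ E2) | apply (HL _ E3) | apply (HL _ E4)];
        try exact Hq; intros x y Hxy; apply (J x y Hxy); auto. }
    unfold ruled. rewrite Ec, Ee. split; [|now apply ruling_field_nullity].
    unfold foot_point. apply R4_ext; to_components; ring.
Qed.
End Direction.
End Ruling.

Lemma open_and_preimage (V : R * R -> Prop) (f : R -> R -> R) (P : R -> Prop) :
  open V -> smooth2 V f -> open P -> open (fun q => V q /\ P (f (fst q) (snd q))).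
Proof.
  intros HV Hf HP [u v] [Hp H0].
  apply filter_and; [exact (HV _ Hp)|].
  pose proof (smooth2_continuity V f u v Hf Hp) as C.
  apply continuity_2d_pt_filterlim in C. exact (C P (HP _ H0)).
Qed.

(** * Surfaces whose second fundamental form has rank one *)

(** All 2x2 minors of the 4x2 matrix obtained by stacking the two coefficient matrices:
    the forms have rank at most one and a common null direction. *)
Definition rank_one (z n n' : R -> R -> R4) (u v : R) : Prop :=
  c11 z n u v * c22 z n u v = c12 z n u v * c12 z n u v /\
  c11 z n' u v * c22 z n' u v = c12 z n' u v * c12 z n' u v /\
  c11 z n' u v * c22 z n u v = c12 z n' u v * c12 z n u v /\
  c11 z n u v * c22 z n' u v = c12 z n' u v * c12 z n u v /\
  c12 z n' u v * c22 z n u v = c22 z n' u v * c12 z n u v /\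
  c12 z n' u v * c11 z n u v = c11 z n' u v * c12 z n u v.

Lemma rank_one_sym z n n' u v : rank_one z n n' u v -> rank_one z n' n u v.
Proof. unfold rank_one. intros [H1 [H2 [H3 [H4 [H5 H6]]]]]. repeat split; lra. Qed.

Lemma normal_to_sub (V Q : R * R -> Prop) z n :
  (forall q, Q q -> V q) -> normal_to V z n -> normal_to Q z n.
Proof.
  intros H [Hn H0]. split; [now apply (smooth_field_sub V)|].
  intros u v Hq; apply H0, H, Hq.
Qed.

Lemma spacelike_tangent V z u v x y : spacelike V z -> V (u, v) -> (x <> 0 \/ y <> 0) ->
  0 < mink (plus (scal x (d_u z u v)) (scal y (d_v z u v)))
           (plus (scal x (d_u z u v)) (scal y (d_v z u v))).
Proof.
  intros Hs Hp Hxy. pose proof (Hs u v Hp x y Hxy) as H.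
  unfold EE, FF, GG in H. mink_expand. rewrite (mink_sym (d_v z u v) (d_u z u v)). lra.
Qed.

(** The constants are adapted to the point: l0 is the ruling vector there, and om is the
    component of z_v orthogonal to l0, so that the derivative of the leaf coordinate in v
    is <om, om> at the point.  This is positive, and everything else holds on a smaller
    neighborhood. *)
Lemma locally_ruled_c22 (V : R * R -> Prop) (z n n' : R -> R -> R4) (u0 v0 : R) :
  open V -> smooth_field V z -> spacelike V z -> normal_to V z n -> normal_to V z n' ->
  normals_span V z n n' -> (forall u v, V (u, v) -> rank_one z n n' u v) ->
  V (u0, v0) -> c22 z n u0 v0 <> 0 -> locally_ruled V z n n' (u0, v0).
Proof.
  intros HV Hz Hs Hn Hn' Hsp Hr V0 C0.
  assert (O0 : open (fun y : R => y <> 0)) by apply open_neq.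
  set (V1 := fun q : R * R => V q /\ c22 z n (fst q) (snd q) <> 0).
  assert (HV1 : open V1).
  { apply (open_and_preimage V (c22 z n) (fun y => y <> 0)); auto. now apply smooth2_c22. }
  assert (S1 : forall q, V1 q -> V q) by (intros q H; apply H).
  assert (c22_1 : forall u v, V1 (u, v) -> c22 z n u v <> 0) by (intros u v H; apply H).
  set (l0 := ruling_vector z n u0 v0).
  assert (L0 : 0 < mink l0 l0).
  { unfold l0, ruling_vector. replace (d_u z u0 v0) with (scal 1 (d_u z u0 v0))
      by (apply R4_ext; to_components; ring).
    apply (spacelike_tangent V z); auto; left; lra. }
  set (V2 := fun q : R * R => V1 q /\ mink (ruling_vector z n (fst q) (snd q)) l0 <> 0).
  assert (HV2 : open V2).
  { apply (open_and_preimage V1 (fun u v => mink (ruling_vector z n u v) l0) (fun y => y <> 0)); auto.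
    apply smooth2_mink; auto using smooth_field_const.
    apply smooth_ruling_vector; auto; [now apply (smooth_field_sub V) | now apply (normal_to_sub V)]. }
  assert (S2 : forall q, V2 q -> V q) by (intros q H; apply S1, H).
  set (r := mink (d_v z u0 v0) l0 / mink l0 l0).
  set (om := minus (d_v z u0 v0) (scal r l0)).
  assert (Om : 0 < mink om om).
  { replace om with (plus (scal (- r) (d_u z u0 v0)) (scal (1 - r * ruling_slope z n u0 v0) (d_v z u0 v0))).
    - apply (spacelike_tangent V z); auto. destruct (Req_dec r 0) as [-> | H]; [right | left]; lra.
    - unfold om, l0, ruling_vector. apply R4_ext; to_components; ring. }
  set (z0 := z u0 v0).
  assert (Hz2 : smooth_field V2 z) by now apply (smooth_field_sub V).
  assert (Hn2 : normal_to V2 z n) by now apply (normal_to_sub V).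
  assert (Hn2' : normal_to V2 z n') by now apply (normal_to_sub V).
  assert (c22_2 : forall u v, V2 (u, v) -> c22 z n u v <> 0) by (intros u v H; apply H).
  assert (l0_2 : forall u v, V2 (u, v) -> mink (ruling_vector z n u v) l0 <> 0) by (intros u v H; apply H).
  assert (Sff : smooth2 V2 (leaf_coordinate z n l0 z0 om)) by (apply smooth_leaf_coordinate; auto).
  set (V3 := fun q : R * R => V2 q /\ 0 < partial_v (leaf_coordinate z n l0 z0 om) (fst q) (snd q)).
  assert (HV3 : open V3).
  { apply (open_and_preimage V2 (partial_v (leaf_coordinate z n l0 z0 om)) (fun y => 0 < y)); auto.
    - now apply smooth2_partial_v.
    - apply open_gt. }
  assert (V20 : V2 (u0, v0)).
  { split; [split; assumption|]. apply Rgt_not_eq. exact L0. }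
  assert (V30 : V3 (u0, v0)).
  { split; [exact V20|]. cbn [fst snd].
    rewrite (proj2 (d_leaf_coordinate V2 z n HV2 Hz2 Hn2 c22_2 l0 z0 om l0_2 u0 v0 V20)).
    rewrite (proj2 (d_foot_point V2 z n HV2 Hz2 Hn2 c22_2 l0 z0 l0_2 u0 v0 V20)).
    replace (height z l0 z0 u0 v0) with 0.
    - match goal with |- 0 < mink ?w _ => replace w with om; [exact Om|] end.
      unfold om, ruling_field, r. fold l0. apply R4_ext; to_components; field; lra.
    - unfold height, z0. mink_expand. ring. }
  assert (S3 : forall q, V3 q -> V q) by (intros q H; apply S2, H).
  destruct (locally_ruled_of_increasing V3 z n n') with (l0 := l0) (z0 := z0) (om := om)
      (u0 := u0) (v0 := v0) as [Q [a [b [c [e [s [t [HQ [Q0 [HQ' HR]]]]]]]]]]; auto.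
  - now apply (smooth_field_sub V).
  - now apply (normal_to_sub V).
  - now apply (normal_to_sub V).
  - intros u v H w; apply Hsp, S3, H.
  - intros u v H; apply c22_2, H.
  - intros u v H. destruct (Hr u v (S3 _ H)) as [R1 [R2 [R3 [R4 [R5 R6]]]]]. auto.
  - intros u v H; apply l0_2, H.
  - intros u v H; apply H.
  - exists Q, a, b, c, e, s, t. split; [exact HQ|]. split; [exact Q0|].
    split; [intros q Hq; apply S3, HQ', Hq | exact HR].
Qed.

Definition swap_set (V : R * R -> Prop) : R * R -> Prop := fun q => V (snd q, fst q).
Definition swap {T : Type} (f : R -> R -> T) : R -> R -> T := fun u v => f v u.

Lemma open_swap V : open V -> open (swap_set V).
Proof.
  intros HV [u v] Hp. apply (locally_2d_locally (fun x y => V (y, x))).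
  destruct (open_locally_2d V V v u HV Hp (fun q H => H)) as [d Hd].
  exists d. intros x y Hx Hy; now apply Hd.
Qed.

Lemma ex_diff_n_swap n : forall f u v, ex_diff_n f n u v -> ex_diff_n (swap f) n v u.
Proof.
  assert (C : forall f u v, continuity_2d_pt f u v -> continuity_2d_pt (swap f) v u).
  { intros f u v H eps. destruct (H eps) as [d Hd]. exists d. intros x y Hx Hy; now apply Hd. }
  induction n as [|n IH]; intros f u v [H0 H]; split; auto.
  destruct H as [H1 [H2 [H3 H4]]]. repeat split; auto.
  - exact (IH _ _ _ H4).
  - exact (IH _ _ _ H3).
Qed.

Lemma smooth2_swap V f : smooth2 V f -> smooth2 (swap_set V) (swap f).
Proof. intros H u v Hp n. apply ex_diff_n_swap, H, Hp. Qed.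

Lemma smooth_field_swap V a : smooth_field V a -> smooth_field (swap_set V) (swap a).
Proof.
  intros [A1 [A2 [A3 A4]]]. repeat split;
  [exact (smooth2_swap V _ A1) | exact (smooth2_swap V _ A2) | exact (smooth2_swap V _ A3)
  | exact (smooth2_swap V _ A4)].
Qed.

Lemma in_span2_sym a b w : in_span2 a b w -> in_span2 b a w.
Proof. intros [s [t ->]]. exists t, s. apply R4_ext; to_components; ring. Qed.

Section Swap.
Variables (V : R * R -> Prop) (z n n' : R -> R -> R4).
Hypotheses (V_open : open V) (z_smooth : smooth_field V z).

Lemma c12_swap nu u v : V (v, u) -> c12 (swap z) (swap nu) u v = c12 z nu v u.
Proof.
  intros Hp. unfold c12. rewrite (d_v_d_u V V_open z v u z_smooth Hp). reflexivity.
Qed.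

(** Exchanging the two parameters reduces the case c11 <> 0 to the case c22 <> 0. *)
Lemma locally_ruled_swap u v :
  locally_ruled (swap_set V) (swap z) (swap n) (swap n') (v, u) -> locally_ruled V z n n' (u, v).
Proof.
  intros [Q [a [b [c [e [s [t [HQ [Q0 [HQ' [Hd [Hs [Ht H]]]]]]]]]]]]].
  exists (swap_set Q), a, b, c, e, (swap s), (swap t).
  split; [now apply open_swap|]. split; [exact Q0|].
  split; [intros [x y] Hq; exact (HQ' (y, x) Hq)|]. split; [exact Hd|].
  split; [now apply smooth2_swap|]. split; [now apply smooth2_swap|].
  intros x y Hq. destruct (H y x Hq) as [H1 [H2 [Hw [p [q [E [K1 [K2 [K3 K4]]]]]]]]].
  split; [exact H1|]. split; [exact H2|]. split; [exact Hw|].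
  rewrite c12_swap in K1, K2, K3, K4 by exact (HQ' _ Hq).
  change (c11 (swap z) (swap n) y x) with (c22 z n x y) in K1.
  change (c11 (swap z) (swap n') y x) with (c22 z n' x y) in K3.
  change (c22 (swap z) (swap n) y x) with (c11 z n x y) in K2.
  change (c22 (swap z) (swap n') y x) with (c11 z n' x y) in K4.
  exists q, p. repeat split; try lra.
  change (e (swap s x y)) with (e (s y x)). rewrite E. apply R4_ext; to_components; unfold d_u, d_v, swap; ring.
Qed.
End Swap.

Lemma locally_ruled_sym V z n n' p : locally_ruled V z n n' p -> locally_ruled V z n' n p.
Proof.
  intros [Q [a [b [c [e [s [t [HQ [Q0 [HQ' [Hd [Hs [Ht H]]]]]]]]]]]]].
  exists Q, a, b, c, e, s, t. repeat (split; [assumption|]).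
  intros x y Hq. destruct (H x y Hq) as [H1 [H2 [Hw [p' [q [E [K1 [K2 [K3 K4]]]]]]]]].
  repeat (split; [assumption|]). exists p', q. auto.
Qed.

Lemma locally_ruled_of_one_normal (V : R * R -> Prop) (z n n' : R -> R -> R4) (u0 v0 : R) :
  open V -> smooth_field V z -> spacelike V z -> normal_to V z n -> normal_to V z n' ->
  normals_span V z n n' -> (forall u v, V (u, v) -> rank_one z n n' u v) ->
  V (u0, v0) -> c11 z n u0 v0 <> 0 \/ c22 z n u0 v0 <> 0 -> locally_ruled V z n n' (u0, v0).
Proof.
  intros HV Hz Hs Hn Hn' Hsp Hr V0 [C0 | C0]; [|now apply locally_ruled_c22].
  apply locally_ruled_swap; auto. apply locally_ruled_c22; auto.
  - now apply open_swap.
  - now apply smooth_field_swap.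
  - intros u v Hp a b Hab. pose proof (Hs v u Hp b a ltac:(tauto)) as H.
    change (EE (swap z) u v) with (GG z v u). change (GG (swap z) u v) with (EE z v u).
    replace (FF (swap z) u v) with (FF z v u) by apply mink_sym. lra.
  - split; [apply smooth_field_swap, Hn|]. intros u v Hp. destruct (proj2 Hn v u Hp). now split.
  - split; [apply smooth_field_swap, Hn'|]. intros u v Hp. destruct (proj2 Hn' v u Hp). now split.
  - intros u v Hp w H1 H2. apply in_span2_sym. exact (Hsp v u Hp w H1 H2).
  - intros u v Hp. unfold rank_one. rewrite !(c12_swap V z HV Hz) by exact Hp.
    destruct (Hr v u Hp) as [R1 [R2 [R3 [R4 [R5 R6]]]]].
    change (c11 (swap z) (swap n) u v) with (c22 z n v u).
    change (c11 (swap z) (swap n') u v) with (c22 z n' v u).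
    change (c22 (swap z) (swap n) u v) with (c11 z n v u).
    change (c22 (swap z) (swap n') u v) with (c11 z n' v u).
    repeat split; lra.
Qed.

Lemma nullity_direction_unique (z n n' : R -> R -> R4) (u v : R) (w w' : R4) :
  c11 z n u v <> 0 \/ c22 z n u v <> 0 \/ c11 z n' u v <> 0 \/ c22 z n' u v <> 0 ->
  nullity_direction z n n' u v w -> nullity_direction z n n' u v w' ->
  exists m, w' = scal m w.
Proof.
  intros Hc [Hw [x [y [E [K1 [K2 [K3 K4]]]]]]] [_ [x' [y' [E' [K1' [K2' [K3' K4']]]]]]].
  assert (D : x * y' - y * x' = 0).
  { assert (T : forall a b c, x * a + y * b = 0 -> x * b + y * c = 0 ->
              x' * a + y' * b = 0 -> x' * b + y' * c = 0 -> a <> 0 \/ c <> 0 -> x * y' - y * x' = 0).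
    { intros a b c A1 A2 A3 A4 [H | H].
      - assert (P : (x * y' - y * x') * a = 0).
        { replace ((x * y' - y * x') * a) with
            (y' * (x * a + y * b) - y * (x' * a + y' * b)) by ring.
          rewrite A1, A3; ring. }
        apply Rmult_integral in P; tauto.
      - assert (P : (x * y' - y * x') * c = 0).
        { replace ((x * y' - y * x') * c) with
            (x * (x' * b + y' * c) - x' * (x * b + y * c)) by ring.
          rewrite A2, A4; ring. }
        apply Rmult_integral in P; tauto. }
    destruct Hc as [H | [H | [H | H]]];
      [apply (T _ _ _ K1 K2 K1' K2') | apply (T _ _ _ K1 K2 K1' K2')
      | apply (T _ _ _ K3 K4 K3' K4') | apply (T _ _ _ K3 K4 K3' K4')]; tauto. }
  destruct (Req_dec x 0) as [X0 | X0]; [destruct (Req_dec y 0) as [Y0 | Y0]|].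
  - exfalso. apply Hw. rewrite E, X0, Y0. apply R4_ext; to_components; ring.
  - exists (y' / y). assert (X' : x' = 0).
    { assert (P : y * x' = 0) by (rewrite X0 in D; lra). apply Rmult_integral in P; tauto. }
    rewrite E, E', X0, X'. apply R4_ext; to_components; field; exact Y0.
  - exists (x' / x). assert (Y' : y' = x' / x * y).
    { apply Rmult_eq_reg_l with x; [|exact X0]. field_simplify; [lra | exact X0]. }
    rewrite E, E', Y'. apply R4_ext; to_components; field; exact X0.
Qed.

Theorem ruled_of_rank_one (V : R * R -> Prop) (z n n' : R -> R -> R4) :
  open V -> smooth_field V z -> spacelike V z -> normal_to V z n -> normal_to V z n' ->
  normals_span V z n n' -> (forall u v, V (u, v) -> rank_one z n n' u v) ->
  (forall u v, V (u, v) -> c11 z n u v <> 0 \/ c22 z n u v <> 0 \/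
     c11 z n' u v <> 0 \/ c22 z n' u v <> 0) ->
  part_of_developable_ruled_surface V z.
Proof.
  intros HV Hz Hs Hn Hn' Hsp Hr Hc.
  (* The null direction is unique up to a factor, so any choice agrees with the direction of
     the local rulings. *)
  exists (fun u v => epsilon (inhabits zero) (nullity_direction z n n' u v)).
  intros [u0 v0] Hp.
  assert (L : locally_ruled V z n n' (u0, v0)).
  { assert (Hsp' : normals_span V z n' n) by (intros u v H w H1 H2; now apply Hsp).
    assert (Hr' : forall u v, V (u, v) -> rank_one z n' n u v)
      by (intros u v H; now apply rank_one_sym, Hr).
    destruct (Hc u0 v0 Hp) as [H | [H | [H | H]]];
      [apply locally_ruled_of_one_normal | apply locally_ruled_of_one_normal
      | apply locally_ruled_sym, locally_ruled_of_one_normal | apply locally_ruled_sym, locally_ruled_of_one_normal]; auto. }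
  destruct L as [Q [a [b [c [e [s [t [HQ [Q0 [HQ' [Hd [Ss [St H]]]]]]]]]]]]].
  exists Q, a, b, c, e, s, t. repeat (split; [assumption|]).
  intros u v Hq. destruct (H u v Hq) as [H1 [H2 H3]]. split; [exact H1|]. split; [exact H2|].
  apply (nullity_direction_unique z n n' u v); [apply Hc, HQ', Hq | | exact H3].
  apply epsilon_spec. now exists (e (s u v)).
Qed.

(** * Surfaces with nonvanishing Gauss curvature on a dense set *)

(** A locally constant function has open level sets, so connectedness leaves only one of
    them. *)
Lemma constant_on_connected (V : R * R -> Prop) (f : R -> R -> R) :
  open V -> connected V ->
  (forall u v, V (u, v) -> is_derive (fun r => f r v) u 0 /\ is_derive (fun r => f u r) v 0) ->
  forall u v u' v', V (u, v) -> V (u', v') -> f u v = f u' v'.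
Proof.
  intros HV HC Hd u v u' v' Hp Hp'.
  assert (MV : forall (h : R -> R) x y, (forall r, Rmin x y <= r <= Rmax x y -> is_derive h r 0) ->
            h x = h y).
  { intros h x y H. destruct (MVT_gen h x y (fun _ => 0)) as [c [_ E]].
    - intros r Hr; apply H; lra.
    - intros r Hr. apply derivable_continuous_pt. exists 0. apply is_derive_Reals, H, Hr.
    - lra. }
  assert (seg : forall x y d r, Rabs (y - x) < d -> Rmin x y <= r <= Rmax x y -> Rabs (r - x) < d).
  { intros x y d r H Hr. apply Rabs_def2 in H. revert Hr. unfold Rmin, Rmax.
    destruct (Rle_dec x y); intros; apply Rabs_def1; lra. }
  assert (loc : forall x y, V (x, y) ->
            locally_2d (fun x' y' => V (x', y') /\ f x' y' = f x y) x y).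
  { intros x y Hq. destruct (open_locally_2d V V x y HV Hq (fun q H => H)) as [d Hbox].
    exists d. intros x' y' Hx Hy. split; [now apply Hbox|].
    assert (Zy : Rabs (y - y) < d) by (rewrite Rminus_diag, Rabs_R0; apply cond_pos).
    transitivity (f x y').
    - symmetry. apply (MV (fun r => f r y')). intros r Hr. refine (proj1 (Hd r y' _)). apply Hbox; [|exact Hy].
      now apply (seg x x').
    - symmetry. apply (MV (fun r => f x r)). intros r Hr. refine (proj2 (Hd x r _)). apply Hbox.
      + rewrite Rminus_diag, Rabs_R0; apply cond_pos.
      + now apply (seg y y'). }
  assert (op : forall P : R -> Prop, open (fun q : R * R => V q /\ P (f (fst q) (snd q)))).
  { intros P [x y] [Hq HP].
    apply (filter_imp (fun q => V (fst q, snd q) /\ P (f (fst q) (snd q)))).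
    { now intros [x' y']. }
    apply (locally_2d_locally (fun x y => V (x, y) /\ P (f x y))).
    destruct (loc x y Hq) as [d H]. exists d. intros x' y' Hx Hy.
    destruct (H x' y' Hx Hy) as [H1 H2]. split; [exact H1|]. now rewrite H2. }
  destruct (Req_dec (f u v) (f u' v')) as [E | NE]; [exact E | exfalso].
  destruct (HC _ _ (op (fun y => y = f u v)) (op (fun y => y <> f u v))) as [q [_ [[_ A] [_ B]]]].
  - intros q Hq. destruct (Req_dec (f (fst q) (snd q)) (f u v)); [left | right]; now split.
  - exists (u, v). repeat split; assumption.
  - exists (u', v'). repeat split; auto.
  - exact (B A).
Qed.

Lemma zero_of_dense (V : R * R -> Prop) (f : R -> R -> R) :
  open V -> smooth2 V f ->
  (forall O : R * R -> Prop, open O -> (exists p, O p) -> (forall p, O p -> V p) ->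
     exists u v, O (u, v) /\ f u v = 0) ->
  forall u v, V (u, v) -> f u v = 0.
Proof.
  intros HV Hf HD u v Hp. destruct (Req_dec (f u v) 0) as [E | NE]; [exact E | exfalso].
  destruct (HD (fun q => V q /\ f (fst q) (snd q) <> 0)) as [x [y [[_ H] E]]].
  - apply (open_and_preimage V f (fun y => y <> 0)); auto. apply open_neq.
  - exists (u, v). now split.
  - intros q H; apply H.
  - exact (H E).
Qed.

(** A basis of the orthogonal complement is written down by solving for a coordinate
    whose coefficient is nonzero. *)
Lemma orthogonal_hyperplane (m : R4) : m <> zero ->
  exists a b c : R4, lin_indep3 a b c /\
    forall q x : R4, mink (minus x q) m = 0 -> in_hyperplane q a b c x.
Proof.
  intros Hm. destruct m as [[[m1 m2] m3] m4].
  assert (indep : forall a b c : R4, (forall r s t : R,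
            (r * x1 a + s * x1 b + t * x1 c = 0 -> r * x2 a + s * x2 b + t * x2 c = 0 ->
             r * x3 a + s * x3 b + t * x3 c = 0 -> r * x4 a + s * x4 b + t * x4 c = 0 ->
             r = 0 /\ s = 0 /\ t = 0)) -> lin_indep3 a b c).
  { intros a b c H r s t E. apply H;
      [exact (f_equal x1 E) | exact (f_equal x2 E) | exact (f_equal x3 E) | exact (f_equal x4 E)]. }
  assert (Z : forall x m, m <> 0 -> x * m = 0 -> x = 0).
  { intros x m H E. apply Rmult_integral in E. tauto. }
  destruct (Req_dec m1 0) as [Z1 | N1]; [destruct (Req_dec m2 0) as [Z2 | N2];
    [destruct (Req_dec m3 0) as [Z3 | N3]; [destruct (Req_dec m4 0) as [Z4 | N4]|]|]|].
  - exfalso. apply Hm. subst. reflexivity.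
  - exists (1, 0, 0, 0), (0, 1, 0, 0), (0, 0, 1, 0). split.
    + apply indep. unfold x1, x2, x3, x4; simpl. intros; lra.
    + intros q x. unfold mink; to_components. intros E.
      exists (x1 x - x1 q), (x2 x - x2 q), (x3 x - x3 q).
      assert (E4 : x4 x - x4 q = 0).
      { apply (Z _ m4 N4). unfold x1, x2, x3, x4 in *; simpl in *. subst. lra. }
      apply R4_ext; to_components; unfold x1, x2, x3, x4 in *; simpl in *; lra.
  - exists (m3, 0, - m1, 0), (0, m3, - m2, 0), (0, 0, m4, m3). split.
    + apply indep. unfold x1, x2, x3, x4; simpl. intros r s t H1 H2 H3 H4.
      assert (r = 0) by (apply (Z r m3 N3); lra). assert (s = 0) by (apply (Z s m3 N3); lra).
      assert (t = 0) by (apply (Z t m3 N3); lra). auto.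
    + intros q x. unfold mink; to_components. intros E.
      exists ((x1 x - x1 q) / m3), ((x2 x - x2 q) / m3), ((x4 x - x4 q) / m3).
      destruct x as [[[y1 y2] y3] y4], q as [[[q1 q2] q3] q4].
      apply R4_ext; to_components; unfold x1, x2, x3, x4 in *; simpl in *.
      1, 2, 4: field; exact N3.
      apply Rmult_eq_reg_r with m3; [|exact N3]. field_simplify; [lra | exact N3].
  - exists (m2, - m1, 0, 0), (0, - m3, m2, 0), (0, m4, 0, m2). split.
    + apply indep. unfold x1, x2, x3, x4; simpl. intros r s t H1 H2 H3 H4.
      assert (r = 0) by (apply (Z r m2 N2); lra). assert (s = 0) by (apply (Z s m2 N2); lra).
      assert (t = 0) by (apply (Z t m2 N2); lra). auto.
    + intros q x. unfold mink; to_components. intros E.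
      exists ((x1 x - x1 q) / m2), ((x3 x - x3 q) / m2), ((x4 x - x4 q) / m2).
      destruct x as [[[y1 y2] y3] y4], q as [[[q1 q2] q3] q4].
      apply R4_ext; to_components; unfold x1, x2, x3, x4 in *; simpl in *.
      1, 3, 4: field; exact N2.
      apply Rmult_eq_reg_r with m2; [|exact N2]. field_simplify; [lra | exact N2].
  - exists (- m2, m1, 0, 0), (- m3, 0, m1, 0), (m4, 0, 0, m1). split.
    + apply indep. unfold x1, x2, x3, x4; simpl. intros r s t H1 H2 H3 H4.
      assert (r = 0) by (apply (Z r m1 N1); lra). assert (s = 0) by (apply (Z s m1 N1); lra).
      assert (t = 0) by (apply (Z t m1 N1); lra). auto.
    + intros q x. unfold mink; to_components. intros E.
      exists ((x2 x - x2 q) / m1), ((x3 x - x3 q) / m1), ((x4 x - x4 q) / m1).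
      destruct x as [[[y1 y2] y3] y4], q as [[[q1 q2] q3] q4].
      apply R4_ext; to_components; unfold x1, x2, x3, x4 in *; simpl in *.
      2, 3, 4: field; exact N1.
      apply Rmult_eq_reg_r with m1; [|exact N1]. field_simplify; [lra | exact N1].
Qed.

(** Twice the determinant EG - F^2 times the coefficient of the mean curvature vector
    along n (up to the sign of <n, n>). *)
Definition trace_form (z n : R -> R -> R4) (u v : R) : R :=
  GG z u v * c11 z n u v - 2 * FF z u v * c12 z n u v + EE z u v * c22 z n u v.

(** The Gauss curvature times EG - F^2; the second bracket is subtracted because <n2, n2> = -1. *)
Definition gauss_numerator (z n1 n2 : R -> R -> R4) (u v : R) : R :=
  (c11 z n1 u v * c22 z n1 u v - c12 z n1 u v * c12 z n1 u v)
  - (c11 z n2 u v * c22 z n2 u v - c12 z n2 u v * c12 z n2 u v).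

Definition forms_proportional (z n1 n2 : R -> R -> R4) (u v : R) : Prop :=
  c11 z n1 u v * trace_form z n2 u v = c11 z n2 u v * trace_form z n1 u v /\
  c12 z n1 u v * trace_form z n2 u v = c12 z n2 u v * trace_form z n1 u v /\
  c22 z n1 u v * trace_form z n2 u v = c22 z n2 u v * trace_form z n1 u v.

Lemma smooth2_trace_form V z n : open V -> smooth_field V z -> normal_to V z n ->
  smooth2 V (trace_form z n).
Proof.
  intros HV Hz Hn.
  assert (Su : smooth_field V (d_u z)) by now apply smooth_field_d_u.
  assert (Sv : smooth_field V (d_v z)) by now apply smooth_field_d_v.
  unfold trace_form. apply smooth2_plus; auto; [apply smooth2_minus; auto|];
  repeat apply smooth2_mult; auto using smooth2_const, smooth2_c11, smooth2_c12, smooth2_c22;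
  apply smooth2_mink; auto.
Qed.

(** The second fundamental tensor is a scalar form s times the normal vector with
    coefficients given by the two traces. *)
Lemma shape_scalars z n1 n2 u v : forms_proportional z n1 n2 u v ->
  trace_form z n1 u v ^ 2 - trace_form z n2 u v ^ 2 <> 0 ->
  exists s11 s12 s22 : R,
    (c11 z n1 u v = trace_form z n1 u v * s11 /\ c12 z n1 u v = trace_form z n1 u v * s12 /\
     c22 z n1 u v = trace_form z n1 u v * s22) /\
    (c11 z n2 u v = trace_form z n2 u v * s11 /\ c12 z n2 u v = trace_form z n2 u v * s12 /\
     c22 z n2 u v = trace_form z n2 u v * s22) /\
    gauss_numerator z n1 n2 u v =
      (trace_form z n1 u v ^ 2 - trace_form z n2 u v ^ 2) * (s11 * s22 - s12 * s12).
Proof.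
  intros [P1 [P2 P3]] Hq.
  set (T1 := trace_form z n1 u v) in *. set (T2 := trace_form z n2 u v) in *.
  set (sh := fun c d : R => (T1 * c - T2 * d) / (T1 ^ 2 - T2 ^ 2)).
  assert (E : forall c d, c * T2 = d * T1 -> c = T1 * sh c d /\ d = T2 * sh c d).
  { intros c d H. unfold sh. split; apply Rmult_eq_reg_r with (T1 ^ 2 - T2 ^ 2); auto.
    - transitivity (T1 * (T1 * c) - T2 * (c * T2)); [ring | rewrite H; field; exact Hq].
    - transitivity (T1 * (d * T1) - T2 * (T2 * d)); [ring | rewrite <- H; field; exact Hq]. }
  destruct (E _ _ P1) as [X1 Y1]. destruct (E _ _ P2) as [X2 Y2]. destruct (E _ _ P3) as [X3 Y3].
  set (s11 := sh _ _) in X1, Y1. set (s12 := sh _ _) in X2, Y2. set (s22 := sh _ _) in X3, Y3.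
  exists s11, s12, s22. repeat (split; [tauto|]).
  unfold gauss_numerator. rewrite X1, X2, X3, Y1, Y2, Y3. ring.
Qed.

Section Hyperplane.
Variables (V : R * R -> Prop) (z n1 n2 : R -> R -> R4).
Hypotheses (V_open : open V) (z_smooth : smooth_field V z)
  (n1_normal : normal_to V z n1) (n2_normal : normal_to V z n2)
  (frame : forall u v, V (u, v) ->
    mink (n1 u v) (n1 u v) = 1 /\ mink (n2 u v) (n2 u v) = -1 /\
    mink (n1 u v) (n2 u v) = 0 /\
    det4 (d_u z u v) (d_v z u v) (n1 u v) (n2 u v) <> 0)
  (prop : forall u v, V (u, v) -> forms_proportional z n1 n2 u v)
  (nonnull : forall u v, V (u, v) ->
     trace_form z n1 u v ^ 2 - trace_form z n2 u v ^ 2 <> 0)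
  (dense : forall O : R * R -> Prop, open O -> (exists p, O p) -> (forall p, O p -> V p) ->
     exists u v, O (u, v) /\ gauss_numerator z n1 n2 u v <> 0).

(** In the normal plane, the direction orthogonal to the mean curvature vector, while
    mean_normal below is a multiple of the mean curvature vector itself. *)
Definition binormal (u v : R) : R4 :=
  minus (scal (trace_form z n2 u v) (n1 u v)) (scal (trace_form z n1 u v) (n2 u v)).
Definition mean_normal (u v : R) : R4 :=
  minus (scal (trace_form z n1 u v) (n1 u v)) (scal (trace_form z n2 u v) (n2 u v)).

Lemma smooth_binormal : smooth_field V binormal.
Proof.
  apply smooth_field_minus; auto; apply smooth_field_scal; auto using smooth2_trace_form;
    [apply n1_normal | apply n2_normal].
Qed.
Lemma smooth_mean_normal : smooth_field V mean_normal.
Proof.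
  apply smooth_field_minus; auto; apply smooth_field_scal; auto using smooth2_trace_form;
    [apply n1_normal | apply n2_normal].
Qed.

Lemma normal_decomposition u v w : V (u, v) ->
  mink w (d_u z u v) = 0 -> mink w (d_v z u v) = 0 ->
  w = minus (scal (mink w (n1 u v)) (n1 u v)) (scal (mink w (n2 u v)) (n2 u v)).
Proof.
  intros Hp Hu Hv.
  destruct (proj2 n1_normal u v Hp) as [A1 A2]. destruct (proj2 n2_normal u v Hp) as [B1 B2].
  destruct (frame u v Hp) as [C1 [C2 [C3 C4]]].
  set (p := mink w (n1 u v)). set (q := mink w (n2 u v)).
  assert (Z : minus w (minus (scal p (n1 u v)) (scal q (n2 u v))) = zero).
  { apply (orthogonal_to_frame (d_u z u v) (d_v z u v) (n1 u v) (n2 u v)); auto; mink_expand.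
    - rewrite (mink_sym (n1 u v)), (mink_sym (n2 u v)), Hu, A1, B1; ring.
    - rewrite (mink_sym (n1 u v)), (mink_sym (n2 u v)), Hv, A2, B2; ring.
    - rewrite C1, (mink_sym (n2 u v)), C3. unfold p; ring.
    - rewrite C2, C3. unfold q; ring. }
  apply R4_ext; [apply (f_equal x1) in Z | apply (f_equal x2) in Z | apply (f_equal x3) in Z
    | apply (f_equal x4) in Z]; revert Z; to_components; intros; lra.
Qed.

Lemma binormal_orthogonal u v : V (u, v) ->
  mink (d_u z u v) (binormal u v) = 0 /\ mink (d_v z u v) (binormal u v) = 0 /\
  mink (d_u (d_u z) u v) (binormal u v) = 0 /\ mink (d_v (d_u z) u v) (binormal u v) = 0 /\
  mink (d_v (d_v z) u v) (binormal u v) = 0.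
Proof.
  intros Hp. destruct (proj2 n1_normal u v Hp) as [A1 A2]. destruct (proj2 n2_normal u v Hp) as [B1 B2].
  destruct (prop u v Hp) as [P1 [P2 P3]]. unfold c11, c12, c22 in P1, P2, P3. unfold binormal. mink_expand.
  rewrite A1, A2, B1, B2. repeat split; lra.
Qed.

Lemma d_binormal_normal u v : V (u, v) ->
  (mink (d_u binormal u v) (d_u z u v) = 0 /\ mink (d_u binormal u v) (d_v z u v) = 0) /\
  (mink (d_v binormal u v) (d_u z u v) = 0 /\ mink (d_v binormal u v) (d_v z u v) = 0).
Proof.
  intros Hp. destruct (binormal_orthogonal u v Hp) as [_ [_ [H11 [H12 H22]]]].
  destruct (mink_constant_d V V_open (d_u z) binormal 0 u v) as [A1 A2];
    auto using smooth_field_d_u, smooth_binormal. { intros x y H; exact (proj1 (binormal_orthogonal x y H)). }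
  destruct (mink_constant_d V V_open (d_v z) binormal 0 u v) as [B1 B2];
    auto using smooth_field_d_v, smooth_binormal. { intros x y H; exact (proj1 (proj2 (binormal_orthogonal x y H))). }
  rewrite <- (d_v_d_u V V_open z u v z_smooth Hp) in B1.
  rewrite !(mink_sym (d_u binormal u v)), !(mink_sym (d_v binormal u v)). lra.
Qed.

(** The fields z_u and z_v are orthogonal to both derivatives of the binormal field;
    differentiate these relations and use the symmetry of the mixed derivatives. *)
Lemma binormal_codazzi u v : V (u, v) ->
  mink (d_v binormal u v) (d_u (d_u z) u v) = mink (d_u binormal u v) (d_v (d_u z) u v) /\
  mink (d_v binormal u v) (d_v (d_u z) u v) = mink (d_u binormal u v) (d_v (d_v z) u v).
Proof.
  intros Hp.
  assert (S1 : smooth_field V (d_u z)) by now apply smooth_field_d_u.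
  assert (S2 : smooth_field V (d_v z)) by now apply smooth_field_d_v.
  assert (Sb := smooth_binormal).
  assert (Sbu : smooth_field V (d_u binormal)) by now apply smooth_field_d_u.
  assert (Sbv : smooth_field V (d_v binormal)) by now apply smooth_field_d_v.
  destruct (mink_constant_d V V_open (d_u binormal) (d_u z) 0 u v) as [_ A1]; auto.
  { intros x y H; exact (proj1 (proj1 (d_binormal_normal x y H))). }
  destruct (mink_constant_d V V_open (d_u binormal) (d_v z) 0 u v) as [_ A2]; auto.
  { intros x y H; exact (proj2 (proj1 (d_binormal_normal x y H))). }
  destruct (mink_constant_d V V_open (d_v binormal) (d_u z) 0 u v) as [B1 _]; auto.
  { intros x y H; exact (proj1 (proj2 (d_binormal_normal x y H))). }
  destruct (mink_constant_d V V_open (d_v binormal) (d_v z) 0 u v) as [B2 _]; auto.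
  { intros x y H; exact (proj2 (proj2 (d_binormal_normal x y H))). }
  rewrite (d_v_d_u V V_open binormal u v Sb Hp) in A1, A2.
  rewrite <- (d_v_d_u V V_open z u v z_smooth Hp) in B2. lra.
Qed.

Lemma shape_determinant u v : V (u, v) -> exists s11 s12 s22 : R,
  gauss_numerator z n1 n2 u v =
    (trace_form z n1 u v ^ 2 - trace_form z n2 u v ^ 2) * (s11 * s22 - s12 * s12) /\
  forall w, mink w (d_u z u v) = 0 -> mink w (d_v z u v) = 0 ->
    mink w (d_u (d_u z) u v) = mink w (mean_normal u v) * s11 /\
    mink w (d_v (d_u z) u v) = mink w (mean_normal u v) * s12 /\
    mink w (d_v (d_v z) u v) = mink w (mean_normal u v) * s22.
Proof.
  intros Hp.
  destruct (shape_scalars z n1 n2 u v (prop u v Hp) (nonnull u v Hp))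
    as [s11 [s12 [s22 [[X1 [X2 X3]] [[Y1 [Y2 Y3]] EK]]]]].
  exists s11, s12, s22. split; [exact EK|].
  intros w Hu Hv. unfold mean_normal. rewrite (normal_decomposition u v w Hp Hu Hv) at 1 3 5.
  mink_expand.
  rewrite !(mink_sym (n1 u v)), !(mink_sym (n2 u v)).
  unfold c11 in X1, Y1; unfold c12 in X2, Y2; unfold c22 in X3, Y3.
  rewrite X1, Y1, X2, Y2, X3, Y3. repeat split; ring.
Qed.

(** With p and q the components of the derivatives, the Codazzi equations read
    q s11 = p s12 and q s12 = p s22, so p = q = 0 where det s <> 0, that is on a dense set. *)
Lemma d_binormal_mean_normal u v : V (u, v) ->
  mink (d_u binormal u v) (mean_normal u v) = 0 /\ mink (d_v binormal u v) (mean_normal u v) = 0.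
Proof.
  assert (K : forall x y, V (x, y) -> gauss_numerator z n1 n2 x y <> 0 ->
            mink (d_u binormal x y) (mean_normal x y) = 0 /\
            mink (d_v binormal x y) (mean_normal x y) = 0).
  { intros x y Hp HK. destruct (shape_determinant x y Hp) as [s11 [s12 [s22 [EK Hs]]]].
    destruct (d_binormal_normal x y Hp) as [[U1 U2] [V1 V2]].
    destruct (Hs _ U1 U2) as [A1 [A2 A3]]. destruct (Hs _ V1 V2) as [B1 [B2 B3]].
    destruct (binormal_codazzi x y Hp) as [C1 C2].
    rewrite A2, B1 in C1. rewrite B2, A3 in C2.
    set (p := mink (d_u binormal x y) (mean_normal x y)) in *.
    set (q := mink (d_v binormal x y) (mean_normal x y)) in *.
    assert (D : s11 * s22 - s12 * s12 <> 0) by (intros D; apply HK; rewrite EK, D; ring).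
    split; apply Rmult_eq_reg_r with (s11 * s22 - s12 * s12); auto; rewrite Rmult_0_l.
    - transitivity (s11 * (p * s22) - s12 * (p * s12)); [ring | rewrite <- C1, <- C2; ring].
    - transitivity (s22 * (q * s11) - s12 * (q * s12)); [ring | rewrite C1, C2; ring]. }
  assert (Sb := smooth_binormal). assert (Sp := smooth_mean_normal).
  intros Hp. split.
  - apply (zero_of_dense V (fun x y => mink (d_u binormal x y) (mean_normal x y))); auto.
    + apply smooth2_mink; auto using smooth_field_d_u.
    + intros O HO Hne HOV. destruct (dense O HO Hne HOV) as [x [y [Hq HK]]].
      exists x, y. split; [exact Hq|]. exact (proj1 (K x y (HOV _ Hq) HK)).
  - apply (zero_of_dense V (fun x y => mink (d_v binormal x y) (mean_normal x y))); auto.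
    + apply smooth2_mink; auto using smooth_field_d_v.
    + intros O HO Hne HOV. destruct (dense O HO Hne HOV) as [x [y [Hq HK]]].
      exists x, y. split; [exact Hq|]. exact (proj2 (K x y (HOV _ Hq) HK)).
Qed.

Lemma normal_parallel_binormal u v w : V (u, v) ->
  mink w (d_u z u v) = 0 -> mink w (d_v z u v) = 0 -> mink w (mean_normal u v) = 0 ->
  exists al, w = scal al (binormal u v).
Proof.
  intros Hp Hu Hv Hw. pose proof (nonnull u v Hp) as Hq.
  pose proof (normal_decomposition u v w Hp Hu Hv) as E.
  revert Hw. unfold mean_normal, binormal. mink_expand.
  set (p := mink w (n1 u v)) in *. set (q := mink w (n2 u v)) in *.
  set (T1 := trace_form z n1 u v) in *. set (T2 := trace_form z n2 u v) in *.
  intros Hw. exists ((q * T1 - p * T2) / (T1 ^ 2 - T2 ^ 2)).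
  assert (Ep : p = (q * T1 - p * T2) / (T1 ^ 2 - T2 ^ 2) * T2).
  { apply Rmult_eq_reg_r with (T1 ^ 2 - T2 ^ 2); auto.
    transitivity (T1 * (T1 * p - T2 * q) + (q * T1 - p * T2) * T2); [ring | rewrite Hw; field; exact Hq]. }
  assert (Eq : q = (q * T1 - p * T2) / (T1 ^ 2 - T2 ^ 2) * T1).
  { apply Rmult_eq_reg_r with (T1 ^ 2 - T2 ^ 2); auto.
    transitivity (T2 * (T1 * p - T2 * q) + (q * T1 - p * T2) * T1); [ring | rewrite Hw; field; exact Hq]. }
  set (al := _ / _) in *. rewrite E. rewrite Ep at 1. rewrite Eq at 1. apply R4_ext; to_components; ring.
Qed.

Lemma mink_binormal u v : V (u, v) -> mink (binormal u v) (binormal u v) <> 0.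
Proof.
  intros Hp. destruct (frame u v Hp) as [C1 [C2 [C3 _]]].
  pose proof (nonnull u v Hp). unfold binormal. mink_expand.
  rewrite C1, C2, (mink_sym (n2 u v)), C3. lra.
Qed.

Lemma is_derive_projection (p q r : R -> R) (s al : R) : r s <> 0 ->
  is_derive p s (al * p s) -> is_derive q s (al * q s) -> is_derive r s (2 * al * r s) ->
  is_derive (fun x => p x * q x / r x) s 0.
Proof.
  intros Hr Hp Hq Hd.
  pose proof (is_derive_div (fun x => p x * q x) r s _ _
    (is_derive_mult p q s _ _ Hp Hq (fun a b => Rmult_comm a b)) Hd Hr) as D.
  apply (is_derive_value _ _ _ _ D). unfold plus, mult; simpl. field. exact Hr.
Qed.

Hypothesis V_connected : connected V.

(** The left-hand side is the orthogonal projection of a fixed vector to the line spanned by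
    the binormal, paired with w.  Since the derivatives of the binormal are multiples of it,
    this projection is constant; no normalization of the binormal, whose square may have
    either sign, is involved. *)
Lemma constant_binormal_direction u0 v0 u v (w : R4) : V (u0, v0) -> V (u, v) ->
  mink (binormal u v) (binormal u0 v0) * mink (binormal u v) w / mink (binormal u v) (binormal u v)
  = mink (binormal u0 v0) w.
Proof.
  intros H0 Hp. set (N0 := binormal u0 v0).
  rewrite (constant_on_connected V
    (fun x y => mink (binormal x y) N0 * mink (binormal x y) w / mink (binormal x y) (binormal x y))
    V_open V_connected) with (u' := u0) (v' := v0); auto.
  - fold N0. field. now apply mink_binormal.
  - clear u v Hp. intros u v Hp.
    destruct (d_binormal_normal u v Hp) as [[U1 U2] [V1 V2]].
    destruct (d_binormal_mean_normal u v Hp) as [U3 V3].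
    destruct (normal_parallel_binormal u v _ Hp U1 U2 U3) as [al Eal].
    destruct (normal_parallel_binormal u v _ Hp V1 V2 V3) as [be Ebe].
    pose proof (smooth_field_curve_u V binormal u v smooth_binormal Hp) as Du.
    pose proof (smooth_field_curve_v V binormal u v smooth_binormal Hp) as Dv.
    pose proof (mink_binormal u v Hp) as Hb.
    split.
    + apply (is_derive_projection (fun r => mink (binormal r v) N0) (fun r => mink (binormal r v) w)
        (fun r => mink (binormal r v) (binormal r v)) u al Hb).
      * eapply is_derive_value; [apply (is_derive_mink (fun r => binormal r v) (fun _ => N0)); auto using differentiable_curve_const|].
        change (velocity (fun r => binormal r v) u) with (d_u binormal u v).
        rewrite Eal, velocity_const. mink_expand. ring.
      * eapply is_derive_value; [apply (is_derive_mink (fun r => binormal r v) (fun _ => w)); auto using differentiable_curve_const|].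
        change (velocity (fun r => binormal r v) u) with (d_u binormal u v).
        rewrite Eal, velocity_const. mink_expand. ring.
      * eapply is_derive_value; [apply (is_derive_mink (fun r => binormal r v) (fun r => binormal r v)); auto|].
        change (velocity (fun r => binormal r v) u) with (d_u binormal u v).
        rewrite Eal. mink_expand. ring.
    + apply (is_derive_projection (fun r => mink (binormal u r) N0) (fun r => mink (binormal u r) w)
        (fun r => mink (binormal u r) (binormal u r)) v be Hb).
      * eapply is_derive_value; [apply (is_derive_mink (fun r => binormal u r) (fun _ => N0)); auto using differentiable_curve_const|].
        change (velocity (fun r => binormal u r) v) with (d_v binormal u v).
        rewrite Ebe, velocity_const. mink_expand. ring.
      * eapply is_derive_value; [apply (is_derive_mink (fun r => binormal u r) (fun _ => w)); auto using differentiable_curve_const|].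
        change (velocity (fun r => binormal u r) v) with (d_v binormal u v).
        rewrite Ebe, velocity_const. mink_expand. ring.
      * eapply is_derive_value; [apply (is_derive_mink (fun r => binormal u r) (fun r => binormal u r)); auto|].
        change (velocity (fun r => binormal u r) v) with (d_v binormal u v).
        rewrite Ebe. mink_expand. ring.
Qed.

Theorem hyperplane_of_dense_curvature : lies_in_hyperplane V z.
Proof.
  destruct (classic (exists p, V p)) as [[[u0 v0] H0] | Hne].
  - set (N0 := binormal u0 v0).
    assert (T : forall u v, V (u, v) -> mink (d_u z u v) N0 = 0 /\ mink (d_v z u v) N0 = 0).
    { intros u v Hp. destruct (binormal_orthogonal u v Hp) as [B1 [B2 _]].
      rewrite mink_sym in B1, B2. rewrite (mink_sym (d_u z u v)), (mink_sym (d_v z u v)).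
      unfold N0. rewrite <- (constant_binormal_direction u0 v0 u v (d_u z u v) H0 Hp),
        <- (constant_binormal_direction u0 v0 u v (d_v z u v) H0 Hp), B1, B2.
      unfold Rdiv; split; ring. }
    destruct (orthogonal_hyperplane N0) as [a [b [c [Hi Hh]]]].
    { intros E. apply (mink_binormal u0 v0 H0). fold N0. rewrite E. apply mink_zero_l. }
    exists (z u0 v0), a, b, c. split; [exact Hi|]. intros u v Hp. apply Hh. mink_expand.
    rewrite (constant_on_connected V (fun x y => mink (z x y) N0) V_open V_connected)
      with (u' := u0) (v' := v0); auto; [ring|].
    intros x y Hq. destruct (T x y Hq) as [T1 T2]. split.
    + eapply is_derive_value; [apply (is_derive_mink (fun r => z r y) (fun _ => N0));
        [apply (smooth_field_curve_u V z); auto | apply differentiable_curve_const]|].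
      change (velocity (fun r => z r y) x) with (d_u z x y).
      rewrite T1, velocity_const, mink_zero_r; ring.
    + eapply is_derive_value; [apply (is_derive_mink (fun r => z x r) (fun _ => N0));
        [apply (smooth_field_curve_v V z); auto | apply differentiable_curve_const]|].
      change (velocity (fun r => z x r) y) with (d_v z x y).
      rewrite T2, velocity_const, mink_zero_r; ring.
  - destruct (orthogonal_hyperplane (1, 0, 0, 0)) as [a [b [c [Hi _]]]].
    { intros E. apply (f_equal x1) in E. unfold x1 in E; simpl in E. 
      change (1 = 0) in E. lra. }
    exists zero, a, b, c. split; [exact Hi|]. intros u v Hp. exfalso. apply Hne. now exists (u, v).
Qed.
End Hyperplane.

(** * Flat points and the alternative *)

Lemma gram_pos D z u v : spacelike D z -> D (u, v) ->
  0 < EE z u v /\ 0 < EE z u v * GG z u v - FF z u v * FF z u v.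
Proof.
  intros Hs Hp.
  assert (HE : 0 < EE z u v) by (pose proof (Hs u v Hp 1 0 ltac:(left; lra)); lra).
  split; [exact HE|].
  pose proof (Hs u v Hp (- FF z u v) (EE z u v) ltac:(right; lra)) as H.
  apply Rmult_lt_reg_l with (EE z u v); [exact HE|]. lra.
Qed.

(** From L N = M^2 and E N + G L = 2 F M, multiplying by L gives
    E M^2 - 2 F M L + G L^2 = 0, and the first fundamental form is positive definite. *)
Lemma flat_Delta D z n1 n2 u v : spacelike D z -> D (u, v) -> flat_point z n1 n2 u v ->
  Delta1 z n1 n2 u v = 0 /\ Delta2 z n1 n2 u v = 0 /\ Delta3 z n1 n2 u v = 0.
Proof.
  intros Hs Hp [Hk Hkap]. destruct (gram_pos D z u v Hs Hp) as [HE HW].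
  assert (W0 : 0 < WW z u v) by now apply sqrt_lt_R0.
  unfold inv_k in Hk; unfold inv_kappa in Hkap.
  assert (Z : forall x d, d <> 0 -> x / d = 0 -> x = 0).
  { intros x d Hd H. apply Rmult_eq_reg_r with (/ d); [|now apply Rinv_neq_0_compat].
    rewrite Rmult_0_l. exact H. }
  apply Z in Hk; [|lra]. apply Z in Hkap; [|lra].
  set (L := LL z n1 n2 u v) in *. set (M := MM z n1 n2 u v) in *. set (N := NN z n1 n2 u v) in *.
  assert (Q : EE z u v * M ^ 2 + 2 * FF z u v * M * - L + GG z u v * (- L) ^ 2 = 0).
  { transitivity (L * (EE z u v * N + GG z u v * L - 2 * FF z u v * M)
                  - EE z u v * (L * N - M * M)); [ring | rewrite Hk, Hkap; ring]. }
  assert (HL : L = 0).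
  { destruct (Req_dec L 0) as [E | NE]; [exact E|].
    pose proof (Hs u v Hp M (- L) ltac:(right; lra)). lra. }
  assert (HM : M = 0).
  { destruct (Req_dec M 0) as [E | NE]; [exact E|].
    pose proof (Hs u v Hp M (- L) ltac:(left; lra)). lra. }
  assert (HN : N = 0).
  { apply Rmult_eq_reg_l with (EE z u v); [|lra]. rewrite HL, HM in Hkap. lra. }
  unfold LL in L; unfold MM in M; unfold NN in N. subst L M N.
  apply Z in HL; [|lra]. apply Z in HM; [|lra]. apply Z in HN; [|lra]. lra.
Qed.

Lemma flat_forms_proportional D z n1 n2 u v : spacelike D z -> D (u, v) -> flat_point z n1 n2 u v ->
  forms_proportional z n1 n2 u v.
Proof.
  intros Hs Hp Hf. destruct (flat_Delta D z n1 n2 u v Hs Hp Hf) as [D1 [D2 D3]].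
  assert (T : forall x y, x - y = 0 -> x = y) by (intros; lra).
  unfold forms_proportional, trace_form. repeat split; apply T.
  - transitivity (- 2 * FF z u v * Delta1 z n1 n2 u v + EE z u v * Delta2 z n1 n2 u v);
      [unfold Delta1, Delta2; ring | rewrite D1, D2; ring].
  - transitivity (- GG z u v * Delta1 z n1 n2 u v + EE z u v * Delta3 z n1 n2 u v);
      [unfold Delta1, Delta3; ring | rewrite D1, D3; ring].
  - transitivity (- GG z u v * Delta2 z n1 n2 u v + 2 * FF z u v * Delta3 z n1 n2 u v);
      [unfold Delta2, Delta3; ring | rewrite D2, D3; ring].
Qed.

(** The mean curvature vector is defined through an orthonormal frame; the one obtained from
    z_u, z_v by orthogonalization shows it to be
    (T_1 n_1 - T_2 n_2) / (2 (EG - F^2)). *)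
Lemma mean_curvature_square D z n1 n2 u v : spacelike D z -> D (u, v) ->
  mink (n1 u v) (n1 u v) = 1 -> mink (n2 u v) (n2 u v) = -1 -> mink (n1 u v) (n2 u v) = 0 ->
  exists h, is_mean_curvature_vector z n1 n2 u v h /\
    4 * (EE z u v * GG z u v - FF z u v * FF z u v) ^ 2 * mink h h =
    trace_form z n1 u v ^ 2 - trace_form z n2 u v ^ 2.
Proof.
  intros Hs Hp N1 N2 N3. destruct (gram_pos D z u v Hs Hp) as [HE HW].
  set (W2 := EE z u v * GG z u v - FF z u v * FF z u v) in *.
  (* Gram-Schmidt: x is z_u divided by its length, and y is a multiple of z_v minus its
     projection to z_u. *)
  set (a := sqrt (/ EE z u v)). set (b := sqrt (EE z u v / W2)).
  assert (Ha : a * a = / EE z u v) by (apply sqrt_sqrt; left; now apply Rinv_0_lt_compat).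
  assert (Hb : b * b = EE z u v / W2) by (apply sqrt_sqrt; left; now apply Rdiv_lt_0_compat).
  set (x := (a, 0)). set (y := (- FF z u v / EE z u v * b, b)).
  exists (scal (/ 2) (plus (Defs.sigma z n1 n2 u v x x) (Defs.sigma z n1 n2 u v y y))). split.
  - exists x, y. unfold tangent, x, y; cbn [fst snd]. mink_expand.
    rewrite (mink_sym (d_v z u v) (d_u z u v)).
    change (mink (d_u z u v) (d_u z u v)) with (EE z u v).
    change (mink (d_u z u v) (d_v z u v)) with (FF z u v).
    change (mink (d_v z u v) (d_v z u v)) with (GG z u v).
    repeat split.
    + transitivity (a * a * EE z u v); [ring | rewrite Ha; field; lra].
    + transitivity (b * b * (W2 / EE z u v)); [unfold W2; field; lra | rewrite Hb; field; lra].
    + field; lra.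
  - assert (E : plus (Defs.sigma z n1 n2 u v x x) (Defs.sigma z n1 n2 u v y y) =
       minus (scal (trace_form z n1 u v / W2) (n1 u v)) (scal (trace_form z n2 u v / W2) (n2 u v))).
    { assert (C : forall n, trace_form z n u v / W2 =
        (a * a + (- FF z u v / EE z u v * b) * (- FF z u v / EE z u v * b)) * c11 z n u v
        + (- FF z u v / EE z u v * b * b + b * (- FF z u v / EE z u v * b)) * c12 z n u v
        + b * b * c22 z n u v).
      { intros n. transitivity ((/ EE z u v + FF z u v * FF z u v / (EE z u v * EE z u v) * (EE z u v / W2)) * c11 z n u v
          - 2 * FF z u v / EE z u v * (EE z u v / W2) * c12 z n u v + EE z u v / W2 * c22 z n u v).
        - unfold trace_form.
          replace (GG z u v) with ((W2 + FF z u v * FF z u v) / EE z u v) by (unfold W2; field; lra).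
          field. split; lra.
        - rewrite <- Ha, <- Hb. field. lra. }
      rewrite !C. unfold Defs.sigma, normal_part, x, y, c11, c12, c22; cbn [fst snd].
      apply R4_ext; to_components; ring. }
    rewrite E. mink_expand. rewrite N1, N2, (mink_sym (n2 u v)), N3. field. lra.
Qed.

Lemma gauss_curvature_numerator z n1 n2 u v :
  mink (n1 u v) (n1 u v) = 1 -> mink (n2 u v) (n2 u v) = -1 -> mink (n1 u v) (n2 u v) = 0 ->
  gauss_curvature z n1 n2 u v =
  gauss_numerator z n1 n2 u v / (EE z u v * GG z u v - FF z u v * FF z u v).
Proof.
  intros N1 N2 N3. unfold gauss_curvature. f_equal.
  unfold Defs.sigma, normal_part; cbn [fst snd]. mink_expand.
  rewrite N1, N2, (mink_sym (n2 u v) (n1 u v)), N3.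
  unfold gauss_numerator, c11, c12, c22. ring.
Qed.

Lemma frame_normals_span D z n1 n2 : spacelike D z -> normal_to D z n1 -> normal_to D z n2 ->
  (forall u v, D (u, v) -> det4 (d_u z u v) (d_v z u v) (n1 u v) (n2 u v) <> 0) ->
  normals_span D z n1 n2.
Proof.
  intros Hs [_ Hn1] [_ Hn2] Hdet u v Hp w H1 H2.
  destruct (gram_pos D z u v Hs Hp) as [_ HW].
  destruct (Hn1 u v Hp) as [A1 A2]. destruct (Hn2 u v Hp) as [B1 B2].
  set (p := mink w (d_u z u v)). set (q := mink w (d_v z u v)).
  set (W2 := EE z u v * GG z u v - FF z u v * FF z u v) in *.
  set (x := (GG z u v * p - FF z u v * q) / W2). set (y := (EE z u v * q - FF z u v * p) / W2).
  exists x, y.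
  assert (Z : minus w (plus (scal x (d_u z u v)) (scal y (d_v z u v))) = zero).
  { apply (orthogonal_to_frame (d_u z u v) (d_v z u v) (n1 u v) (n2 u v)); auto; mink_expand;
      rewrite ?A1, ?A2, ?B1, ?B2, ?H1, ?H2; try ring;
      rewrite ?(mink_sym (d_v z u v) (d_u z u v));
      fold p; fold q;
      change (mink (d_u z u v) (d_u z u v)) with (EE z u v);
      change (mink (d_u z u v) (d_v z u v)) with (FF z u v);
      change (mink (d_v z u v) (d_v z u v)) with (GG z u v);
      unfold x, y, W2 in *; field; lra. }
  apply R4_ext; [apply (f_equal x1) in Z | apply (f_equal x2) in Z | apply (f_equal x3) in Z
    | apply (f_equal x4) in Z]; revert Z; to_components; intros; lra.
Qed.

(** Vanishing Gauss curvature means det s = 0, and s is not zero because its trace is not. *)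
Lemma rank_one_of_flat z n1 n2 u v : forms_proportional z n1 n2 u v ->
  trace_form z n1 u v ^ 2 - trace_form z n2 u v ^ 2 <> 0 -> gauss_numerator z n1 n2 u v = 0 ->
  rank_one z n1 n2 u v /\
  (c11 z n1 u v <> 0 \/ c22 z n1 u v <> 0 \/ c11 z n2 u v <> 0 \/ c22 z n2 u v <> 0).
Proof.
  intros HP HT HK.
  destruct (shape_scalars z n1 n2 u v HP HT)
    as [s11 [s12 [s22 [[X1 [X2 X3]] [[Y1 [Y2 Y3]] EK]]]]].
  set (T1 := trace_form z n1 u v) in *. set (T2 := trace_form z n2 u v) in *.
  rewrite HK in EK. symmetry in EK. apply Rmult_integral in EK.
  destruct EK as [EK | Ds]; [contradiction|].
  assert (Es : s11 * s22 = s12 * s12) by lra.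
  split.
  - unfold rank_one. rewrite X1, X2, X3, Y1, Y2, Y3.
    assert (R : forall a b, a * s11 * (b * s22) = a * s12 * (b * s12)).
    { intros a b. transitivity (a * b * (s11 * s22)); [ring | rewrite Es; ring]. }
    repeat split; try apply R; try ring. rewrite R; ring.
  - apply NNPP. intros H. apply not_or_and in H. destruct H as [H1 H].
    apply not_or_and in H. destruct H as [H2 H]. apply not_or_and in H. destruct H as [H3 H4].
    apply NNPP in H1, H2, H3, H4.
    assert (Q : forall s, T1 * s = 0 -> T2 * s = 0 -> s = 0).
    { intros s E1 E2. assert (E : (T1 ^ 2 - T2 ^ 2) * s = 0).
      { transitivity (T1 * (T1 * s) - T2 * (T2 * s)); [ring | rewrite E1, E2; ring]. }
      apply Rmult_integral in E; tauto. }
    assert (Z1 : s11 = 0) by (apply Q; lra). assert (Z2 : s22 = 0) by (apply Q; lra).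
    assert (Z3 : s12 = 0).
    { rewrite Z1, Rmult_0_l in Es. symmetry in Es. apply Rmult_integral in Es; tauto. }
    rewrite Z3, Rmult_0_r in X2, Y2.
    apply HT. unfold T1, T2, trace_form. rewrite H1, H2, H3, H4, X2, Y2. ring.
Qed.

(** Either the Gauss curvature vanishes on some nonempty open part of O in D, and no point
    there is type-changing, or it vanishes on none, and no point of O is. *)
Lemma type_changing_nowhere_dense D z n1 n2 (O : R * R -> Prop) :
  open D -> open O -> (exists p, O p) ->
  exists O' : R * R -> Prop, open O' /\ (exists p, O' p) /\
    forall p, O' p -> O p /\ ~ type_changing D z n1 n2 p.
Proof.
  intros HD HO [p0 Hp0].
  destruct (classic (exists p, O p /\ D p)) as [[p1 [H1 H2]] | HN].
  - destruct (classic (exists Q : R * R -> Prop, open Q /\ (exists q, Q q) /\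
      forall u v, Q (u, v) -> (O (u, v) /\ D (u, v)) /\ gauss_curvature z n1 n2 u v = 0))
      as [[Q [HQ [HQ0 HQ1]]] | HNQ].
    + exists Q. split; [exact HQ|]. split; [exact HQ0|].
      intros [u v] Hp. split; [apply HQ1, Hp|].
      intros [_ HT]. destruct (HT Q HQ Hp) as [[x [y [Hq [_ HK]]]] _]. apply HK, HQ1, Hq.
    + exists (fun p => O p /\ D p). split; [now apply open_and|].
      split; [now exists p1|]. intros p Hp. split; [apply Hp|].
      intros [_ HT]. destruct (HT _ (open_and _ _ HO HD) Hp) as [_ [Q [HQ [HQ0 HQ1]]]].
      apply HNQ. exists Q. split; [exact HQ|]. split; [exact HQ0|].
      intros u v Hq. destruct (HQ1 u v Hq) as [A [_ B]]. now split.
  - exists O. split; [exact HO|]. split; [now exists p0|].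
    intros p Hp. split; [exact Hp|]. intros [HDp _]. apply HN. now exists p.
Qed.

(** The points near which the Gauss curvature vanishes and those near which it vanishes on
    no nonempty open set form two disjoint open sets, and they cover V. *)
Lemma curvature_dichotomy D z n1 n2 (V : R * R -> Prop) :
  open D -> open V -> connected V ->
  (forall p, V p -> D p /\ ~ type_changing D z n1 n2 p) ->
  (forall u v, V (u, v) -> gauss_curvature z n1 n2 u v = 0) \/
  (forall O : R * R -> Prop, open O -> (exists p, O p) -> (forall p, O p -> V p) ->
     exists u v, O (u, v) /\ gauss_curvature z n1 n2 u v <> 0).
Proof.
  intros HD HV HC HVD.
  set (A := fun p : R * R => exists Q : R * R -> Prop, open Q /\ Q p /\
    forall u v, Q (u, v) -> D (u, v) -> gauss_curvature z n1 n2 u v = 0).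
  set (B := fun p : R * R => exists Q : R * R -> Prop, open Q /\ Q p /\
    ~ exists O : R * R -> Prop, open O /\ (exists q, O q) /\
       forall u v, O (u, v) -> Q (u, v) /\ D (u, v) /\ gauss_curvature z n1 n2 u v = 0).
  assert (AO : open A).
  { intros p [Q [HQ [Hp H]]]. apply (filter_imp Q); [|exact (HQ p Hp)].
    intros q Hq. exists Q. auto. }
  assert (BO : open B).
  { intros p [Q [HQ [Hp H]]]. apply (filter_imp Q); [|exact (HQ p Hp)].
    intros q Hq. exists Q. auto. }
  assert (cover : forall p, V p -> A p \/ B p).
  { intros p Hp. destruct (HVD p Hp) as [Dp HT].
    apply NNPP. intros HN. apply not_or_and in HN. destruct HN as [NA NB].
    apply HT. split; [exact Dp|]. intros Q HQ Hq. split.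
    - apply NNPP. intros H. apply NA. exists Q. split; [exact HQ|]. split; [exact Hq|].
      intros u v H1 H2. apply NNPP. intros H3. apply H. now exists u, v.
    - apply NNPP. intros H. apply NB. now exists Q. }
  assert (disj : forall p, V p -> A p -> B p -> False).
  { intros p Hp [Q [HQ [H1 H2]]] [Q' [HQ' [H1' H2']]]. apply H2'.
    exists (fun q => (Q q /\ Q' q) /\ D q). split; [repeat apply open_and; assumption|].
    split; [exists p; split; [now split | apply HVD, Hp]|].
    intros u v [[K1 K2] K3]. auto. }
  destruct (classic (exists p, V p /\ B p)) as [HB | HB].
  - right. intros O HO [p Hp] HOV.
    assert (Bp : B p).
    { destruct (cover p (HOV p Hp)) as [Ap | Bp]; [|exact Bp]. exfalso.
      destruct (HC A B AO BO cover) as [q [H1 [H2 H3]]]; [|exact HB | exact (disj q H1 H2 H3)].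
      exists p. split; [now apply HOV | exact Ap]. }
    destruct Bp as [Q [HQ [H1 H2]]].
    apply NNPP. intros H. apply H2. exists (fun q => O q /\ Q q).
    split; [now apply open_and|]. split; [now exists p|].
    intros u v [K1 K2]. split; [exact K2|]. split; [apply HVD, HOV, K1|].
    apply NNPP. intros K3. apply H. now exists u, v.
  - left. intros u v Hp. destruct (cover _ Hp) as [[Q [HQ [H1 H2]]] | Bp].
    + apply H2; [exact H1 | apply HVD, Hp].
    + exfalso. apply HB. now exists (u, v).
Qed.

Theorem theorem4p1 (D : R * R -> Prop) (z n1 n2 : R -> R -> R4)
  (D_open : open D) (D_connected : connected D)
  (z_smooth : smooth_field D z)
  (z_spacelike : spacelike D z)
  (n_frame : normal_frame D z n1 n2)
  (z_flat : forall u v : R, D (u, v) -> flat_point z n1 n2 u v)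
  (H_nonnull : forall u v : R, D (u, v) ->
     forall H : R4, is_mean_curvature_vector z n1 n2 u v H ->
       mink H H > 0 \/ mink H H < 0) :
  (* the type-changing points are nowhere dense ... *)
  (forall O : R * R -> Prop, open O -> (exists p, O p) ->
     exists O' : R * R -> Prop, open O' /\ (exists p, O' p) /\
       forall p, O' p -> O p /\ ~ type_changing D z n1 n2 p) /\
  (* ... and away from them (with V = D when there are none) *)
  (forall V : R * R -> Prop, open V -> connected V ->
     (forall p, V p -> D p /\ ~ type_changing D z n1 n2 p) ->
     lies_in_hyperplane V z \/ part_of_developable_ruled_surface V z).
Proof.
  split; [intros O HO Hne; now apply type_changing_nowhere_dense|].
  intros V V_open V_connected HVD.
  destruct n_frame as [Sn1 [Sn2 Hn]].
  assert (VD : forall q, V q -> D q) by (intros q Hq; apply HVD, Hq).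
  assert (SV : smooth_field V z) by now apply (smooth_field_sub D).
  assert (HsV : spacelike V z) by (intros u v Hp; apply z_spacelike, VD, Hp).
  assert (Nn1 : normal_to V z n1).
  { split; [now apply (smooth_field_sub D)|]. intros u v Hp.
    rewrite !(mink_sym _ (n1 u v)). destruct (Hn u v (VD _ Hp)) as [H1 [H2 _]]. now split. }
  assert (Nn2 : normal_to V z n2).
  { split; [now apply (smooth_field_sub D)|]. intros u v Hp.
    rewrite !(mink_sym _ (n2 u v)). destruct (Hn u v (VD _ Hp)) as [_ [_ [H1 [H2 _]]]]. now split. }
  assert (frame : forall u v, V (u, v) ->
    mink (n1 u v) (n1 u v) = 1 /\ mink (n2 u v) (n2 u v) = -1 /\
    mink (n1 u v) (n2 u v) = 0 /\ det4 (d_u z u v) (d_v z u v) (n1 u v) (n2 u v) <> 0).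
  { intros u v Hp. destruct (Hn u v (VD _ Hp)) as [_ [_ [_ [_ [H1 [H2 [H3 H4]]]]]]].
    repeat split; auto. lra. }
  assert (prop : forall u v, V (u, v) -> forms_proportional z n1 n2 u v).
  { intros u v Hp. apply (flat_forms_proportional V); auto. }
  assert (nonnull : forall u v, V (u, v) ->
            trace_form z n1 u v ^ 2 - trace_form z n2 u v ^ 2 <> 0).
  { intros u v Hp. destruct (frame u v Hp) as [F1 [F2 [F3 _]]].
    destruct (mean_curvature_square V z n1 n2 u v HsV Hp F1 F2 F3) as [h [Hh E]].
    destruct (gram_pos V z u v HsV Hp) as [_ HW].
    assert (mink h h <> 0) by (destruct (H_nonnull u v (VD _ Hp) h Hh); lra).
    rewrite <- E. repeat apply Rmult_integral_contrapositive_currified; try lra. }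
  assert (gauss : forall u v, V (u, v) ->
            gauss_curvature z n1 n2 u v = 0 <-> gauss_numerator z n1 n2 u v = 0).
  { intros u v Hp. destruct (frame u v Hp) as [F1 [F2 [F3 _]]].
    rewrite (gauss_curvature_numerator z n1 n2 u v F1 F2 F3).
    destruct (gram_pos V z u v HsV Hp) as [_ HW]. split; intros H.
    - apply Rmult_integral in H. destruct H as [H | H]; [exact H|].
      apply Rinv_neq_0_compat in H; [contradiction | lra].
    - rewrite H. unfold Rdiv; ring. }
  destruct (curvature_dichotomy D z n1 n2 V D_open V_open V_connected HVD) as [HK | HK].
  - right.
    assert (dev : forall u v, V (u, v) -> rank_one z n1 n2 u v /\
      (c11 z n1 u v <> 0 \/ c22 z n1 u v <> 0 \/ c11 z n2 u v <> 0 \/ c22 z n2 u v <> 0)).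
    { intros u v Hp. apply rank_one_of_flat; auto. apply gauss; auto. }
    apply (ruled_of_rank_one V z n1 n2); auto; try (intros u v Hp; apply dev, Hp).
    apply frame_normals_span; auto. intros u v Hp; apply frame, Hp.
  - left. apply (hyperplane_of_dense_curvature V z n1 n2); auto.
    intros O HO Hne HOV. destruct (HK O HO Hne HOV) as [u [v [H1 H2]]].
    exists u, v. split; [exact H1|]. intros H3. apply H2, gauss; auto.
Qed.
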